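(* Let $G$ be a finite simple graph and let $G'$ be a graph obtained from $G$ by a ''free cut edge'' switching. Then (a) $\beta_{i,j}(J_G)=\beta_{i,j}(J_{G'})$ for all $i,j$; (b) $\mathrm{pd}(J_G)=\mathrm{pd}(J_{G'})$; (c) $\mathrm{reg}(J_G)=\mathrm{reg}(J_{G'})$.
   Context: Let $K$ be a field. For a finite simple graph $G$ with vertex set $[n]$ and edge set $E(G)$, let $S=K[x_1,\ldots,x_n,y_1,\ldots,y_n]$ (standard grading); the binomial edge ideal $J_G\subset S$ is generated by the binomials $x_iy_j-x_jy_i$ with $i<j$ and $\{i,j\}\in E(G)$. Here $\beta_{i,j}$, $\mathrm{pd}$ and $\mathrm{reg}$ denote graded Betti numbers, projective dimension and Castelnuovo–Mumford regularity over $S$. For an edge $e$ of $G$, $G\setminus e$ is the graph on the same vertex set with $e$ removed; for a non-edge $e=\{v,w\}$ ($v\ne w$), $G\cup e$ is the graph obtained by adding the edge $e$. An edge $e$ is a cut edge of $G$ if $G\setminus e$ has more connected components than $G$. The clique complex $\Delta(G)$ is the simplicial complex whose facets are the vertex sets of the maximal cliques of $G$. A vertex of $G$ is a free vertex if it is contained in only one facet of $\Delta(G)$. A cut edge $e$ of $G$ is a free cut edge of $G$ if both its endpoints are free vertices of $G\setminus e$. If $e$ is a free cut edge of $G$, then a graph of the form $G'=(G\setminus e)\cup e'$ is said to be obtained from $G$ by ''free cut edge'' switching if $e'$ is a free cut edge of $G'$. *)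

(* Defs.v *)
From HB Require Import structures.
From mathcomp Require Import all_boot all_order all_algebra.
From mathcomp Require Import mpoly.
From Stdlib Require Import ClassicalEpsilon.

Set Implicit Arguments.
Unset Strict Implicit.
Unset Printing Implicit Defensive.

Import Order.TTheory GRing.Theory Num.Theory.
Local Open Scope ring_scope.

(* mpoly shadows ssrbool's symmetric. *)
Record sgraph (n : nat) := SGraph {
  adj :> rel 'I_n;
  adj_sym : ssrbool.symmetric adj;
  adj_irr : irreflexive adj
}.

Definition del_edge (n : nat) (G : rel 'I_n) (u v : 'I_n) : rel 'I_n :=
  [rel a b | G a b && ([set a; b] != [set u; v])].

(* Meant for u != v only: otherwise it creates a loop. *)
Definition add_edge (n : nat) (G : rel 'I_n) (u v : 'I_n) : rel 'I_n :=
  [rel a b | G a b || ([set a; b] == [set u; v])].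

Definition cut_edge (n : nat) (G : rel 'I_n) (u v : 'I_n) : bool :=
  G u v && (n_comp G predT < n_comp (del_edge G u v) predT)%N.

Definition clique (n : nat) (G : rel 'I_n) (A : {set 'I_n}) : bool :=
  [forall a in A, forall b in A, (a != b) ==> G a b].

Definition clique_complex (n : nat) (G : rel 'I_n) : {set {set 'I_n}} :=
  [set A | clique G A].

Definition facet (n : nat) (D : {set {set 'I_n}}) (F : {set 'I_n}) : bool :=
  maxset (fun A => A \in D) F.

Definition free_vertex (n : nat) (G : rel 'I_n) (v : 'I_n) : bool :=
  #|[set F : {set 'I_n} | facet (clique_complex G) F & v \in F]| == 1%N.

Definition free_cut_edge (n : nat) (G : rel 'I_n) (u v : 'I_n) : bool :=
  [&& cut_edge G u v, free_vertex (del_edge G u v) u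
    & free_vertex (del_edge G u v) v].

(* e = {u, v} and e' = {u', v'}; since the union with e' is taken for a       *)
(* non-edge e', the latter is not an edge of G \ e (but e' = e is allowed).   *)
Definition free_cut_edge_switching (n : nat) (G G' : rel 'I_n) : Prop :=
  exists u v u' v' : 'I_n,
    [/\ free_cut_edge G u v,
        u' != v',
        ~~ del_edge G u v u' v',
        G' =2 add_edge (del_edge G u v) u' v'
      & free_cut_edge G' u' v'].

(* x_i is 'X_(lshift n i) and y_i is 'X_(rshift n i). Here and below, ideals   *)
(* are given by their membership predicates.                                  *)
Definition edge_binomial (K : fieldType) (n : nat) (i j : 'I_n) :
    {mpoly K[n + n]} :=
  'X_(lshift n i) * 'X_(rshift n j) - 'X_(lshift n j) * 'X_(rshift n i).

Definition binomial_edge_ideal (K : fieldType) (n : nat) (G : rel 'I_n)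
    (f : {mpoly K[n + n]}) : Prop :=
  exists c : 'I_n -> 'I_n -> {mpoly K[n + n]},
    f = \sum_(i < n) \sum_(j < n | (i < j)%N && G i j)
          c i j * edge_binomial K i j.

(* With S = {mpoly K[N]}, F_i = S(-d_0) + ... + S(-d_(r-1)) where              *)
(* r = gf_rank i and d_k = gf_deg k. Elements are row vectors and maps act by *)
(* right multiplication: row k of gf_diff i is the image in F_i of the k-th   *)
(* basis vector of F_(i+1), and gf_aug lists the images in S of the basis     *)
(* vectors of F_0. Degrees in nat suffice for minimal resolutions of ideals,  *)
(* since no matrix of such a resolution has a zero row.                       *)
Record graded_free_data (K : fieldType) (N : nat) := GradedFreeData {
  gf_rank : nat -> nat;
  gf_deg : forall i : nat, 'I_(gf_rank i) -> nat;
  gf_diff : forall i : nat, 'M[{mpoly K[N]}]_(gf_rank i.+1, gf_rank i);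
  gf_aug : 'cV[{mpoly K[N]}]_(gf_rank 0)
}.

Definition gf_homogeneous (K : fieldType) (N : nat)
    (F : graded_free_data K N) : Prop :=
  (forall k, gf_aug F k 0 \is (gf_deg k).-homog) /\
  (forall i k l, gf_diff F i k l != 0 ->
     exists2 d : nat, gf_deg k = (gf_deg l + d)%N & gf_diff F i k l \is d.-homog).

Definition gf_exact (K : fieldType) (N : nat) (I : {mpoly K[N]} -> Prop)
    (F : graded_free_data K N) : Prop :=
  [/\ forall f, I f <-> exists v : 'rV_(gf_rank F 0), f%:M = v *m gf_aug F,
      forall v : 'rV_(gf_rank F 0),
        v *m gf_aug F = 0 <-> exists w, v = w *m gf_diff F 0
    & forall i (v : 'rV_(gf_rank F i.+1)),
        v *m gf_diff F i = 0 <-> exists w, v = w *m gf_diff F i.+1].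

(* All differentials have entries in the maximal ideal (X_0, ..., X_(N-1)). *)
Definition gf_minimal (K : fieldType) (N : nat)
    (F : graded_free_data K N) : Prop :=
  forall i k l, (gf_diff F i k l)@_0%MM = 0.

Definition minimal_graded_free_resolution (K : fieldType) (N : nat)
    (I : {mpoly K[N]} -> Prop) (F : graded_free_data K N) : Prop :=
  [/\ gf_homogeneous F, gf_exact I F & gf_minimal F].

(* The number of summands S(-j) of F_i. *)
Definition gf_betti (K : fieldType) (N : nat) (F : graded_free_data K N)
    (i j : nat) : nat :=
  #|[set k : 'I_(gf_rank F i) | gf_deg k == j]|.

(* Minimal graded free resolutions of a homogeneous ideal exist and are      *)
(* unique up to isomorphism, so that epsilon picks the only possible value.   *)
Definition betti (K : fieldType) (N : nat) (I : {mpoly K[N]} -> Prop)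
    (i j : nat) : nat :=
  epsilon (inhabits 0%N) (fun b : nat =>
    exists2 F : graded_free_data K N,
      minimal_graded_free_resolution I F & b = gf_betti F i j).

Definition projective_module (R : nzRingType) (P : lmodType R) : Prop :=
  forall (M Q : lmodType R) (g : {linear M -> Q}) (f : {linear P -> Q}),
    (forall y, exists x, g x = y) ->
    exists h : {linear P -> M}, forall p, g (h p) = f p.

(* 0 -> P_d -> ... -> P_1 -> P_0 -> I -> 0 *)
Definition has_projective_resolution (R : nzRingType) (I : R -> Prop)
    (d : nat) : Prop :=
  exists (P : nat -> lmodType R)
         (phi : forall i : nat, {linear P i.+1 -> P i})
         (aug : {linear P 0%N -> R^o}),
    [/\ forall i, projective_module (P i),
        forall i, (d < i)%N -> forall v : P i, v = 0,
        forall f, I f <-> exists v, aug v = f,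
        forall v, aug v = 0 <-> exists w, v = phi 0%N w
      & forall i (v : P i.+1), phi i v = 0 <-> exists w, v = phi i.+1 w].

(* Over a polynomial ring over a field the minimum exists, by Hilbert's      *)
(* syzygy theorem. The zero ideal gets 0, not -oo.   *)
Definition proj_dim (K : fieldType) (N : nat) (I : {mpoly K[N]} -> Prop) :
    nat :=
  epsilon (inhabits 0%N) (fun d : nat =>
    has_projective_resolution I d /\
    forall d' : nat, has_projective_resolution I d' -> (d <= d')%N).

(* Castelnuovo-Mumford regularity is max {j - i | beta_(i,j) <> 0}; the        *)
(* maximum exists for a nonzero homogeneous ideal. *)
Definition regularity (K : fieldType) (N : nat) (I : {mpoly K[N]} -> Prop) :
    int :=
  epsilon (inhabits (0 : int)) (fun r : int =>
    (exists i j : nat, betti I i j <> 0%N /\ r = j%:Z - i%:Z) /\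
    forall i j : nat, betti I i j <> 0%N -> j%:Z - i%:Z <= r).

(* Main.v *)
(* Let H = G \ e = G' \ e', with e = {u, v}. The binomial f_e is a nonzerodivisor
   modulo J_H, so the mapping cone of multiplication by f_e on the minimal
   resolution of J_H is the minimal resolution of J_G = J_H + (f_e). Its ranks
   and degrees depend only on H and on deg f_e = 2, hence agree with those of
   J_G'.

   For the nonzerodivisor property in a graph G where N(u) and N(v) are cliques
   and u, v are not connected, let w have two nonadjacent neighbours, let G_w be
   G with N(w) completed to a clique, and G - w be G with w isolated. Then J_G =
   J_{G_w} \cap (J_{G - w} + (x_w, y_w)), so the claim passes from G_w and G -
   w to G. Both graphs have fewer vertices with two nonadjacent neighbours, and
   neither u nor v becomes one, nor do they become connected. If there is no
   such w, then G is a disjoint union of cliques and J_G is the kernel of x_i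
   |-> a_i s_c(i), y_i |-> a_i, with c(i) the component of i; the image of f_e
   is nonzero because u and v lie in different components.

   The Betti numbers and the projective dimension are read off any minimal
   resolution: composites of comparison maps are homotopic to the identity, and
   the homotopy terms vanish modulo the maximal ideal. *)

Require Import Defs.
From HB Require Import structures.
From mathcomp Require Import all_boot all_order all_algebra.
From mathcomp Require Import mpoly ring.
From Stdlib Require Import ClassicalEpsilon.
From Stdlib Require Import FunctionalExtensionality PropExtensionality.

Set Implicit Arguments.
Unset Strict Implicit.
Unset Printing Implicit Defensive.

Import Order.TTheory GRing.Theory Num.Theory.
Local Open Scope ring_scope.

(** * Projective resolutions and comparison maps *)

(** The recursion runs over pairs of an element and a proof of its invariant [Q], each successor
    being picked by indefinite description. *)
Lemma dependent_choice_nat (T : nat -> Type) (Q : forall i, T i -> Prop)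
    (R : forall i, T i -> T i.+1 -> Prop) (x0 : T 0%N) :
  Q 0%N x0 ->
  (forall i x, Q i x -> exists2 y, R i x y & Q i.+1 y) ->
  exists2 s : forall i, T i, s 0%N = x0 & forall i, R i (s i) (s i.+1).
Proof.
move=> Q0 step.
have step' i (x : {x : T i | Q i x}) :
    {y : {y : T i.+1 | Q i.+1 y} | R i (sval x) (sval y)}.
  apply: constructive_indefinite_description; case: x => x Qx.
  by have [y Rxy Qy] := step i x Qx; exists (exist _ y Qy).
pose s := fix s i : {x : T i | Q i x} :=
  if i is j.+1 then sval (step' j (s j)) else exist _ x0 Q0.
exists (fun i => sval (s i)) => // i.
exact: svalP (step' i (s i)).
Qed.

Definition mk_linear (R : nzRingType) (U V : lmodType R) (f : U -> V)
    (fL : linear f) : {linear U -> V} :=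
  HB.pack f (GRing.isLinear.Build R U V *:%R f fL).

Section Pullback.
Variables (R : nzRingType) (M P Q : lmodType R).
Variables (g : {linear M -> Q}) (f : {linear P -> Q}).

Definition pullback_pred : {pred M * P} := fun x => g x.1 == f x.2.

Fact pullback_submod_closed : GRing.submod_closed pullback_pred.
Proof.
split=> [|a x y]; rewrite !unfold_in; first by rewrite /= !linear0.
by move=> /eqP gx /eqP gy; rewrite /= !linearP gx gy.
Qed.

HB.instance Definition _ :=
  GRing.isSubmodClosed.Build R (M * P)%type pullback_pred pullback_submod_closed.

Record pullback := Pullback {
  pullback_val :> M * P; _ : pullback_val \in pullback_pred }.

HB.instance Definition _ := [isSub for pullback_val].
HB.instance Definition _ := [Choice of pullback by <:].
HB.instance Definition _ := [SubChoice_isSubLmodule of pullback by <:].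

(** [projective_module] lifts only along surjections. The projection of the fibre product of [g] and
    [f] to [P] is one, so it has a section, whose first component is the lift. *)
Lemma projective_lift :
  projective_module P -> (forall p, exists x, g x = f p) ->
  exists h : {linear P -> M}, forall p, g (h p) = f p.
Proof.
move=> projP img.
have l2 : linear (fun x : pullback => (val x).2).
  by move=> a x y /=.
have l1 : linear (fun x : pullback => (val x).1).
  by move=> a x y /=.
have [|h hP] := projP pullback P (mk_linear l2) idfun.
  move=> p; have [x gx] := img p.
  have xp : (x, p) \in pullback_pred by rewrite unfold_in /= gx.
  by exists (Pullback xp).
exists (mk_linear l1 \o h) => p /=.
have /eqP -> : g (val (h p)).1 == f (val (h p)).2 by case: (h p).
by rewrite [X in f X]hP.
Qed.

End Pullback.

Section Comparison.
Variables (R : nzRingType) (E E' : nat -> lmodType R).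
Variables (d : forall i, {linear E i.+1 -> E i}).
Variables (d' : forall i, {linear E' i.+1 -> E' i}).
Hypothesis projE : forall i, projective_module (E i.+1).
Hypothesis complexE : forall i x, d i (d i.+1 x) = 0.
Hypothesis exactE' : forall i y, d' i y = 0 -> exists z, d' i.+1 z = y.

(** Once [phi i.+1] is built, d' i (phi i.+1 (d i.+1 x)) = phi i (d i (d i.+1 x)) = 0, so exactness
    and projectivity yield the next map. *)
Lemma chain_map_lift (phi0 : {linear E 0%N -> E' 0%N}) :
  (forall x, exists y, d' 0%N y = phi0 (d 0%N x)) ->
  exists2 phi : forall i, {linear E i -> E' i},
    phi 0%N = phi0 & forall i x, d' i (phi i.+1 x) = phi i (d i x).
Proof.
move=> im0.
pose Q i (phi : {linear E i -> E' i}) :=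
  forall x, exists y, d' i y = phi (d i x).
pose S i (phi : {linear E i -> E' i}) (psi : {linear E i.+1 -> E' i.+1}) :=
  forall x, d' i (psi x) = phi (d i x).
apply: (@dependent_choice_nat _ Q S) => // i phi Qphi.
have [psi psiP] := @projective_lift _ _ _ _ (d' i) (phi \o d i) (@projE i) Qphi.
exists psi => // x; apply: exactE'.
by rewrite psiP /= complexE linear0.
Qed.

(** The homotopy starts at 0 because [psi 0] vanishes. At each stage the remaining error
    [psi i.+1 - h i d i] is a cycle, hence a boundary, and lifts to [h i.+1]. *)
Lemma null_homotopy (psi : forall i, {linear E i -> E' i}) :
  (forall x, psi 0%N x = 0) ->
  (forall i x, d' i (psi i.+1 x) = psi i (d i x)) ->
  exists2 h : forall i, {linear E i -> E' i.+1},
    forall x, h 0%N x = 0 &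
    forall i x, psi i.+1 x = d' i.+1 (h i.+1 x) + h i (d i x).
Proof.
move=> psi0 psid.
pose Q i (h : {linear E i -> E' i.+1}) :=
  forall x, exists z, d' i.+1 z = (psi i.+1 \- (h \o d i)) x.
pose S i (h : {linear E i -> E' i.+1}) (h' : {linear E i.+1 -> E' i.+2}) :=
  forall x, psi i.+1 x = d' i.+1 (h' x) + h (d i x).
have [|i h Qh|h h0 hP] := @dependent_choice_nat _ Q S \0.
  move=> x; apply: exactE'.
  by rewrite /= subr0 psid psi0.
2: by exists h => // x; rewrite h0.
have [h' h'P] := @projective_lift _ _ _ _ (d' i.+1) (psi i.+1 \- (h \o d i))
  (@projE i) Qh.
exists h' => [x|x]; first by rewrite h'P /= subrK.
apply: exactE'; rewrite /= linearB /= psid h'P /= complexE linear0 subr0.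
by rewrite subrr.
Qed.

End Comparison.

(** * Graded matrices *)

Section GradedMatrices.
Variables (K : fieldType) (N : nat).
Local Notation S := {mpoly K[N]}.

Lemma pihomogM e d (p q : S) : q \is e.-homog ->
  pihomog mdeg d (p * q) =
    if (e <= d)%N then pihomog mdeg (d - e) p * q else 0.
Proof.
move=> hq; elim/mpolyind: p => [|c m p _ _ IH].
  by rewrite mul0r !linear0 mul0r if_same.
rewrite mulrDl !linearD /= IH -scalerAl !linearZ /= pihomogX.
have hXq : 'X_[m] * q \is (mdeg m + e)%N.-homog.
  by apply: dhomogM; rewrite ?dhomogX.
case: (leqP e d) => led; last first.
  rewrite addr0 (@pihomog_ne0 _ _ _ (mdeg m + e)) ?scaler0 //.
  by apply: contraTneq led => <-; rewrite -leqNgt leq_addl.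
rewrite mulrDl; congr (_ + _); case: eqP => [md|/eqP md].
  by rewrite pihomog_dE -?scalerAl // -(subnK led) -md.
rewrite scaler0 mul0r (@pihomog_ne0 _ _ _ (mdeg m + e)) ?scaler0 //.
by apply: contraNneq md => <-; rewrite addnK.
Qed.

(** These are the matrices of degree-preserving maps from the sum of the S(-d k) to the sum of the
    S(-d' l). A zero entry is exempt because d k may then be smaller than d' l. *)
Definition hom_mx r s (d : 'I_r -> nat) (d' : 'I_s -> nat) (A : 'M[S]_(r, s)) :=
  forall k l, A k l != 0 ->
    exists2 e : nat, d k = (d' l + e)%N & A k l \is e.-homog.

(** The degree-preserving component of an arbitrary map; the test guards the truncated
    subtraction. *)
Definition gpart r s (d : 'I_r -> nat) (d' : 'I_s -> nat) (A : 'M[S]_(r, s)) :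
    'M[S]_(r, s) :=
  \matrix_(k, l)
    if (d' l <= d k)%N then pihomog mdeg (d k - d' l) (A k l) else 0.

Lemma hom_gpart r s d d' (A : 'M_(r, s)) : hom_mx d d' (gpart d d' A).
Proof.
move=> k l; rewrite mxE; case: leqP => [le _|_]; last by rewrite eqxx.
by exists (d k - d' l)%N; rewrite ?subnKC //; apply: pihomogP.
Qed.

Lemma gpart_id r s d d' (A : 'M_(r, s)) : hom_mx d d' A -> gpart d d' A = A.
Proof.
move=> homA; apply/matrixP=> k l; rewrite mxE.
have [->|/homA[e -> he]] := eqVneq (A k l) 0; first by rewrite linear0 if_same.
by rewrite leq_addr addKn pihomog_dE.
Qed.

Fact gpart_is_zmod_morphism r s d d' :
  zmod_morphism (@gpart r s d d').
Proof.
move=> A B; apply/matrixP=> k l; rewrite !mxE.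
by case: ifP; rewrite ?linearB ?subrr.
Qed.

HB.instance Definition _ r s d d' :=
  GRing.isZmodMorphism.Build _ _ (@gpart r s d d') (gpart_is_zmod_morphism d d').

Lemma gpart_mulr r s t d d' d'' (A : 'M_(r, s)) (D : 'M_(s, t)) :
  hom_mx d' d'' D -> gpart d d'' (A *m D) = gpart d d' A *m D.
Proof.
move=> homD; apply/matrixP=> k l; rewrite !mxE.
under [RHS]eq_bigr => j _ do rewrite mxE.
have [le|lt] := leqP (d'' l) (d k).
  rewrite linear_sum; apply: eq_bigr => j _ /=.
  have [->|/homD[e dj he]] := eqVneq (D j l) 0; first by rewrite !mulr0 linear0.
  rewrite (pihomogM _ _ he) dj leq_subRL // addnC subnDA subnAC.
  by case: leqP; rewrite ?mul0r.
rewrite big1 // => j _; have [->|/homD[e dj he]] := eqVneq (D j l) 0.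
  by rewrite mulr0.
by rewrite ifN ?mul0r // -ltnNge (leq_trans lt) // dj leq_addr.
Qed.

Lemma gpart_mull r s t d d' d'' (D : 'M_(r, s)) (A : 'M_(s, t)) :
  hom_mx d d' D -> gpart d d'' (D *m A) = D *m gpart d' d'' A.
Proof.
move=> homD; apply/matrixP=> k l; rewrite !mxE.
under [RHS]eq_bigr => j _ do rewrite mxE.
have [le|lt] := leqP (d'' l) (d k).
  rewrite linear_sum; apply: eq_bigr => j _ /=.
  have [->|/homD[e dk he]] := eqVneq (D k j) 0; first by rewrite !mul0r linear0.
  rewrite mulrC (pihomogM _ _ he) leq_subRL // dk leq_add2r.
  by rewrite -subnDA subnDr mulrC; case: leqP; rewrite ?mulr0.
rewrite big1 // => j _; have [->|/homD[e dk he]] := eqVneq (D k j) 0.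
  by rewrite mul0r.
rewrite ifN ?mulr0 // -ltnNge (leq_ltn_trans _ lt) // dk leq_addr //.
Qed.

(** Reduction modulo the ideal of the variables. *)
Definition cst_mx r s (A : 'M[S]_(r, s)) : 'M[K]_(r, s) := map_mx (mcoeff 0%MM) A.

Lemma hom_mx_cst r s d d' (A : 'M_(r, s)) k l :
  hom_mx d d' A -> d k != d' l -> cst_mx A k l = 0.
Proof.
move=> homA ne; rewrite mxE; have [->|/homA[e dk he]] := eqVneq (A k l) 0.
  by rewrite mcoeff0.
apply: (dhomog_nemf_coeff he); rewrite mf0.
by apply: contraNneq ne => e0; rewrite dk -e0 addn0.
Qed.

(* [cst_mx A] only links equal degrees, so that its block of degree j is
   inverted on the right by the corresponding block of [cst_mx B]. *)
Lemma hom_mx_card_le r s d d' (A : 'M_(r, s)) (B : 'M_(s, r)) j :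
  hom_mx d d' A -> cst_mx A *m cst_mx B = 1%:M ->
  (#|[set k | d k == j]| <= #|[set l | d' l == j]|)%N.
Proof.
move=> homA AB1; set J := [set k | _]; set J' := [set l | _].
pose f (k : 'I_#|J|) := enum_val k; pose f' (l : 'I_#|J'|) := enum_val l.
apply: (@mulmx1_min _ _ _ (mxsub f f' (cst_mx A)) (mxsub f' f (cst_mx B))).
apply/matrixP=> a b; rewrite !mxE.
have /matrixP/(_ (f a) (f b)) := AB1.
rewrite !mxE (inj_eq enum_val_inj) => <-; symmetry.
rewrite (bigID (mem J')) /= [X in _ + X]big1 ?addr0.
  rewrite (big_enum_val (fun l => cst_mx A (f a) l * cst_mx B l (f b))).
  by apply: eq_bigr => i _; rewrite !mxE.
move=> l lJ; rewrite (hom_mx_cst homA) ?mul0r //.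
have := enum_valP a; rewrite inE => /eqP ->.
by move: lJ; rewrite inE eq_sym.
Qed.

End GradedMatrices.

(** * Invariants of minimal resolutions *)

Lemma free_projective (R : comNzRingType) (r : nat) :
  projective_module ('rV[R]_r : lmodType R).
Proof.
move=> M Q g f surj.
pose m k := sval (constructive_indefinite_description _ (surj (f (delta_mx 0 k)))).
have gm k : g (m k) = f (delta_mx 0 k).
  by rewrite /m; case: constructive_indefinite_description.
have hL : linear (fun v : 'rV[R]_r => \sum_k v 0 k *: m k).
  move=> a u v; rewrite scaler_sumr -big_split; apply: eq_bigr => k _ /=.
  by rewrite !mxE scalerDl scalerA.
exists (mk_linear hL) => v /=.
rewrite [X in f X]row_sum_delta !linear_sum; apply: eq_bigr => k _.
by rewrite !linearZ /= gm.
Qed.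

Section Resolutions.
Variables (K : fieldType) (N : nat).
Local Notation S := {mpoly K[N]}.
Implicit Types (I : S -> Prop) (F : graded_free_data K N).

(* The augmented complex E_0 = S, E_(i+1) = F_i. *)
Definition aug_rank F (i : nat) : nat := if i is j.+1 then gf_rank F j else 1%N.

Definition aug_deg F (i : nat) : 'I_(aug_rank F i) -> nat :=
  match i return 'I_(aug_rank F i) -> nat with
  | 0 => fun _ => 0%N
  | j.+1 => @gf_deg _ _ F j
  end.

Definition aug_diff F (i : nat) : 'M[S]_(aug_rank F i.+1, aug_rank F i) :=
  match i return 'M[S]_(aug_rank F i.+1, aug_rank F i) with
  | 0 => gf_aug F
  | j.+1 => gf_diff F j
  end.

Arguments aug_deg : clear implicits.

Lemma aug_diff_hom F i :
  gf_homogeneous F -> hom_mx (aug_deg F i.+1) (aug_deg F i) (aug_diff F i).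
Proof.
case: i => [|i] [h0 h1] k l /=; last exact: h1.
by rewrite [l]ord1 => _; exists (gf_deg k) => //; apply: h0.
Qed.

Lemma aug_diff_exact I F i (v : 'rV_(aug_rank F i.+1)) :
  gf_exact I F ->
  v *m aug_diff F i = 0 <-> exists w, v = w *m aug_diff F i.+1.
Proof. by case: i v => [|i] v [_ h0 h1]; [apply: h0|apply: h1]. Qed.

Lemma aug_diff_im I F f :
  gf_exact I F -> I f <-> exists v, f%:M = v *m aug_diff F 0.
Proof. by case=> h _ _; apply: h. Qed.

Lemma aug_diffK I F i : gf_exact I F -> aug_diff F i.+1 *m aug_diff F i = 0.
Proof.
move=> exF; apply/row_matrixP=> k; rewrite row_mul row0.
by apply/(aug_diff_exact _ exF); exists (delta_mx 0 k); rewrite rowE.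
Qed.

Definition aug_mod F (i : nat) : lmodType S := 'rV[S]_(aug_rank F i).

Definition aug_map F (i : nat) : {linear aug_mod F i.+1 -> aug_mod F i} :=
  mulmxr (aug_diff F i).

Lemma aug_mapK I F i x : gf_exact I F -> aug_map F i (aug_map F i.+1 x) = 0.
Proof. by move=> exF; rewrite /= -mulmxA (aug_diffK _ exF) mulmx0. Qed.

Lemma aug_map_exact I F i y :
  gf_exact I F -> aug_map F i y = 0 -> exists z, aug_map F i.+1 z = y.
Proof.
by move=> exF /(aug_diff_exact _ exF)[z ->]; exists z.
Qed.

Lemma aug_map_proj F i : projective_module (aug_mod F i.+1).
Proof. exact: free_projective. Qed.

(** The difference from the identity is null-homotopic; its homotopy terms contain differentials,
    which minimality makes vanish modulo the variables. *)
Lemma minimal_null_homotopic I F (psi : forall i, 'M[S]_(aug_rank F i)) :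
  minimal_graded_free_resolution I F -> psi 0%N = 1%:M ->
  (forall i, psi i.+1 *m aug_diff F i = aug_diff F i *m psi i) ->
  forall i, cst_mx (psi i) = 1%:M.
Proof.
case=> homF exF minF psi0 psid.
pose p i : {linear aug_mod F i -> aug_mod F i} := mulmxr (psi i - 1%:M).
have [|||i x|h h0 hP] := @null_homotopy _ _ _ (aug_map F) (aug_map F)
  (@aug_map_proj F) _ _ p.
- by move=> i x; apply: (aug_mapK _ exF).
- by move=> i y; apply: (aug_map_exact exF).
- by move=> x; rewrite /= psi0 subrr mulmx0.
- rewrite /= -!mulmxA; congr (_ *m _).
  by rewrite mulmxBl mulmxBr psid mul1mx mulmx1.
case=> [|i]; first by rewrite psi0 /cst_mx map_mx1.
pose H i := lin1_mx (h i) : 'M_(aug_rank F i, aug_rank F i.+1).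
have HE j (v : 'rV_(aug_rank F j)) : h j v = v *m H j by rewrite mul_rV_lin1.
have psiE : psi i.+1 = 1%:M + H i.+1 *m aug_diff F i.+1 + aug_diff F i *m H i.
  apply/row_matrixP=> k; rewrite !rowE.
  have := hP i (delta_mx 0 k); rewrite /= !HE mulmxBr => /(canRL (subrK _)) ->.
  by rewrite !mulmxDr !mulmxA addrC addrA.
have cstD : cst_mx (gf_diff F i) = 0.
  by apply/matrixP=> k l; rewrite !mxE minF.
rewrite psiE /cst_mx !map_mxD map_mx1 !map_mxM /= -/(cst_mx (gf_diff F i)) cstD.
rewrite mulmx0 addr0.
(* For i = 0 the remaining term passes through [gf_aug], which [gf_minimal] does not constrain;
   there [H 0] is zero. *)
case: i psiE cstD => [|i] psiE cstD.
  have -> : H 0%N = 0 by apply/row_matrixP=> k; rewrite rowE -HE h0 row0.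
  by rewrite map_mx0 mulmx0 addr0.
rewrite (_ : map_mx _ (aug_diff F i.+1) = 0) ?mul0mx ?addr0 //.
by apply/matrixP=> k l; rewrite !mxE minF.
Qed.

(** A lift of the identity of S need not preserve degrees. Its degree-preserving part still commutes
    with the homogeneous differentials and is still the identity at index 0. *)
Lemma graded_chain_map I F F' :
  minimal_graded_free_resolution I F -> minimal_graded_free_resolution I F' ->
  exists A : forall i, 'M[S]_(aug_rank F i, aug_rank F' i),
    [/\ A 0%N = 1%:M,
        forall i, A i.+1 *m aug_diff F' i = aug_diff F i *m A i
      & forall i, hom_mx (aug_deg F i) (aug_deg F' i) (A i)].
Proof.
move=> [homF exF minF] [homF' exF' minF'].
have [|||phi phi0 phid] := @chain_map_lift _ _ _ (aug_map F) (aug_map F')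
  (@aug_map_proj F) _ _ (idfun : {linear aug_mod F 0 -> aug_mod F' 0}).
- by move=> i x; apply: (aug_mapK _ exF).
- by move=> i y; apply: (aug_map_exact exF').
- move=> x /=; set f := x *m _.
  have /(aug_diff_im _ exF')[v vP] : I (f 0 0).
    by apply/(aug_diff_im _ exF); exists x; rewrite -mx11_scalar.
  by exists v; rewrite -vP -mx11_scalar.
pose A i := lin1_mx (phi i) : 'M_(aug_rank F i, aug_rank F' i).
have AE i (v : 'rV_(aug_rank F i)) : phi i v = v *m A i by rewrite mul_rV_lin1.
exists (fun i => gpart (aug_deg F i) (aug_deg F' i) (A i)).
split=> [|i|i]; last exact: hom_gpart.
  have -> : A 0%N = 1%:M by apply/row_matrixP=> k; rewrite !rowE -AE phi0 mulmx1.
  rewrite gpart_id // => k l; rewrite !ord1 => _; exists 0%N => //.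
  by rewrite mxE eqxx dhomog1.
rewrite -(gpart_mulr _ _ (aug_diff_hom homF')).
rewrite -(gpart_mull _ _ (aug_diff_hom homF)); congr gpart.
apply/row_matrixP=> k; rewrite !rowE !mulmxA -AE.
have := phid i (delta_mx 0 k); rewrite /= => ->.
by rewrite AE.
Qed.

(** Comparison maps in both directions compose to a lift of the identity, whose constant part is the
    identity; this bounds the size of each degree block. Exchanging F and F' gives equality. *)
Lemma gf_betti_le I F F' i j :
  minimal_graded_free_resolution I F -> minimal_graded_free_resolution I F' ->
  (gf_betti F i j <= gf_betti F' i j)%N.
Proof.
move=> resF resF'.
have [A [A0 Ad homA]] := graded_chain_map resF resF'.
have [B [B0 Bd homB]] := graded_chain_map resF' resF.
apply: (@hom_mx_card_le _ _ _ _ _ _ (A i.+1) (B i.+1) _ (homA i.+1)).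
rewrite /cst_mx -map_mxM -/(cst_mx _).
apply: (minimal_null_homotopic (psi := fun i => A i *m B i) resF).
  by rewrite A0 B0 mulmx1.
by move=> k; rewrite -mulmxA Bd mulmxA Ad mulmxA.
Qed.

Lemma bettiE I F i j :
  minimal_graded_free_resolution I F -> betti I i j = gf_betti F i j.
Proof.
move=> resF; rewrite /betti.
case: (epsilon_spec (inhabits 0%N) (fun b => exists2 F : graded_free_data K N,
      minimal_graded_free_resolution I F & b = gf_betti F i j)).
  by exists (gf_betti F i j), F.
by move=> F' resF' ->; apply/eqP; rewrite eqn_leq !(@gf_betti_le I).
Qed.

Lemma free_has_projective_resolution I F d :
  gf_exact I F -> (forall i, (d < i)%N -> gf_rank F i = 0%N) ->
  has_projective_resolution I d.
Proof.
move=> [exI ex0 ex1] rank0.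
have augL : linear (fun v : 'rV_(gf_rank F 0) => (v *m gf_aug F) 0 0 : S^o).
  by move=> a u v; rewrite mulmxDl -scalemxAl !mxE.
exists (fun i => 'rV[S]_(gf_rank F i)).
exists (fun i => mulmxr (gf_diff F i)), (mk_linear augL).
split=> [i|i lt_di v|f|v|i v].
- exact: free_projective.
- by apply/rowP=> k; move: (ltn_ord k); rewrite {2}rank0.
- rewrite exI; split=> -[v]; last first.
    by move=> <-; exists v; rewrite /= -mx11_scalar.
  by move=> vE; exists v; rewrite /= -vE mxE eqxx.
- rewrite -ex0; split=> [v0|v0]; last by rewrite /= v0 mxE.
  have {}v0 : (v *m gf_aug F) 0 0 = 0 by [].
  by rewrite [LHS]mx11_scalar v0 raddf0.
- exact: ex1.
Qed.

(** Lifts of the identity of S from F to the projective resolution and back compose to a map with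
    identity constant part. For i > d this map factors through P i = 0, so F_i has rank zero. *)
Lemma has_projective_resolution_rank I F d :
  minimal_graded_free_resolution I F -> has_projective_resolution I d ->
  forall i, (d < i)%N -> gf_rank F i = 0%N.
Proof.
move=> resF; have [homF exF minF] := resF.
move=> [P [phi [aug [projP P0 imP ex0 ex1]]]].
pose E i : lmodType S := if i is j.+1 then P j else S^o.
pose dE i : {linear E i.+1 -> E i} :=
  match i return {linear E i.+1 -> E i} with
  | 0 => aug
  | j.+1 => phi j
  end.
have exE i y : dE i y = 0 -> exists z, dE i.+1 z = y.
  by case: i y => [|i] y /=; [move/ex0|move/ex1] => -[w ->]; exists w.
have dEK i x : dE i (dE i.+1 x) = 0.
  by case: i x => [|i] x /=; [apply/ex0|apply/ex1]; exists x.
have l0 : linear (fun v : aug_mod F 0 => v 0 0 : E 0%N).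
  by move=> a u v; rewrite !mxE.
have l1 : linear (fun f : E 0%N => (f : S)%:M : aug_mod F 0).
  by move=> a u v; rewrite raddfD /= scale_scalar_mx.
have [|||f f0 fd] := @chain_map_lift _ _ _ (aug_map F) dE
  (@aug_map_proj F) _ _ (mk_linear l0).
- by move=> i x; apply: (aug_mapK _ exF).
- exact: exE.
- move=> x; apply/imP/(aug_diff_im _ exF).
  by exists x; rewrite /= -mx11_scalar.
have [||||g g0 gd] := @chain_map_lift _ _ _ dE (aug_map F) _ _ _ (mk_linear l1).
- exact: projP.
- exact: dEK.
- by move=> i y; apply: (aug_map_exact exF).
- move=> x; have /(aug_diff_im _ exF)[v vE] : I (aug x) by apply/imP; exists x.
  by exists v; rewrite /= -vE.
pose gf i : {linear aug_mod F i -> aug_mod F i} := g i \o f i.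
pose M i := lin1_mx (gf i) : 'M_(aug_rank F i).
have ME i (v : 'rV_(aug_rank F i)) : v *m M i = g i (f i v).
  by rewrite mul_rV_lin1.
move=> i lt_di; apply/eqP; rewrite -leqn0 leqNgt; apply/negP=> rank_gt0.
have M0 : M 0%N = 1%:M.
  by apply/row_matrixP=> k; rewrite rowE ME f0 g0 /= -mx11_scalar row1.
have Md j : M j.+1 *m aug_diff F j = aug_diff F j *m M j.
  apply/row_matrixP=> k; rewrite !rowE !mulmxA !ME.
  have := gd j (f j.+1 (delta_mx 0 k)); rewrite /= => ->.
  by have := fd j (delta_mx 0 k); rewrite /= => ->.
have := minimal_null_homotopic resF M0 Md i.+1.
have -> : M i.+1 = 0.
  apply/row_matrixP=> k; rewrite rowE ME row0.
  by rewrite (P0 i lt_di (f i.+1 _)) linear0.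
rewrite /cst_mx map_mx0 => /matrixP/(_ (Ordinal rank_gt0) (Ordinal rank_gt0)).
by rewrite !mxE eqxx => /esym/eqP; rewrite oner_eq0.
Qed.

Lemma minimal_resolution_proj_dim I F d :
  minimal_graded_free_resolution I F ->
  has_projective_resolution I d <->
  (forall i, (d < i)%N -> gf_rank F i = 0%N).
Proof.
move=> resF; split; first exact: has_projective_resolution_rank.
by case: resF => _ exF _; apply: free_has_projective_resolution.
Qed.

End Resolutions.

(** * Noetherian modules *)

Lemma mpoly_ring_ind (R : comNzRingType) (N : nat) (P : {mpoly R[N]} -> Prop) :
  (forall c, P c%:MP) -> (forall i, P 'X_i) ->
  (forall p q, P p -> P q -> P (p + q)) ->
  (forall p q, P p -> P q -> P (p * q)) ->
  forall p, P p.
Proof.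
move=> PC PX PD PM; elim/mpolyind=> [|c m p _ _ Pp]; first by rewrite -mpolyC0.
apply: PD => //; rewrite -mul_mpolyC; apply: (PM) => //.
rewrite mpolyXE_id; apply: (big_ind P _ PM) => [|i _]; first exact: (PC 1).
by elim: (m i) => [|k IH]; [exact: (PC 1)|rewrite exprS; apply: PM].
Qed.

Section Noetherian.
Variable R : comNzRingType.

Definition submodule (V : lmodType R) (M : V -> Prop) : Prop :=
  M 0 /\ forall a x y, M x -> M y -> M (a *: x + y).

(** Taking the intersection of all submodules containing [A] turns arguments about generators into
    closure checks, with no explicit linear combinations. *)
Definition span_of (V : lmodType R) (A : V -> Prop) (x : V) : Prop :=
  forall M, submodule M -> (forall y, A y -> M y) -> M x.

Definition noetherian_module (V : lmodType R) : Prop :=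
  forall M : V -> Prop, submodule M ->
    exists2 t : seq V, forall x, x \in t -> M x
      & forall x, M x -> span_of (fun y => y \in t) x.

Lemma span_of_submodule (V : lmodType R) (A : V -> Prop) : submodule (span_of A).
Proof.
split=> [M [] //|a x y Ax Ay M subM AM].
by case: (subM) => _; apply; [apply: Ax|apply: Ay].
Qed.

Lemma span_of_gen (V : lmodType R) (A : V -> Prop) x : A x -> span_of A x.
Proof. by move=> Ax M _; apply. Qed.

Lemma span_of_mono (V : lmodType R) (A B : V -> Prop) x :
  (forall y, A y -> B y) -> span_of A x -> span_of B x.
Proof. by move=> AB Ax M subM BM; apply: Ax => // y /AB/BM. Qed.

Section Submodule.
Variables (V : lmodType R) (M : V -> Prop).
Hypothesis subM : submodule M.

Lemma submoduleZ a x : M x -> M (a *: x).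
Proof. by case: subM => M0 Ml Mx; rewrite -[_ *: _]addr0; apply: Ml. Qed.

Lemma submoduleD x y : M x -> M y -> M (x + y).
Proof. by case: subM => _ Ml Mx My; rewrite -[x]scale1r; apply: Ml. Qed.

Lemma submoduleN x : M x -> M (- x).
Proof. by rewrite -scaleN1r; apply: submoduleZ. Qed.

Lemma submoduleB x y : M x -> M y -> M (x - y).
Proof. by move=> Mx My; apply/submoduleD/submoduleN. Qed.

Lemma submodule_sum (T : Type) (r : seq T) (P : pred T) (F : T -> V) :
  (forall i, P i -> M (F i)) -> M (\sum_(i <- r | P i) F i).
Proof.
by move=> MF; apply: big_ind => //; [case: subM|apply: submoduleD].
Qed.

End Submodule.

Lemma submodule_preim (U V : lmodType R) (f : {linear U -> V}) (M : V -> Prop) :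
  submodule M -> submodule (fun x => M (f x)).
Proof. by case=> M0 Ml; split=> [|a x y]; rewrite ?linear0 // linearP; apply: Ml. Qed.

(** Generators of [M] are lifts in [M] of generators of f(M), together with the images of generators
    of the preimage of [M] under [g]. If x' is a combination of the lifts with f x' = f x, then x -
    x' lies in [M] and in the image of [g]. *)
Lemma noetherian_extension (U V W : lmodType R)
    (g : {linear U -> V}) (f : {linear V -> W}) :
  (forall x, f x = 0 -> exists b, g b = x) ->
  noetherian_module U -> noetherian_module W -> noetherian_module V.
Proof.
move=> ker_f noethU noethW M subM.
have [|tw twM twS] := noethW (fun y => exists2 x, M x & f x = y).
  split=> [|a _ _ [x Mx <-] [y My <-]]; first by exists 0; rewrite ?linear0; case: subM.
  by exists (a *: x + y); rewrite ?linearP //; case: subM => _; apply.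
have [t1 t1M ft1] : exists2 t1, forall x, x \in t1 -> M x & map f t1 = tw.
  elim: tw {twS} twM => [|y tw IH] twM; first by exists [::].
  have [x|t1 t1M <-] := IH; first by move=> xtw; apply: twM; rewrite inE xtw orbT.
  have [|x Mx <-] := twM y; first by rewrite inE eqxx.
  by exists (x :: t1) => // z; rewrite inE => /predU1P[->|/t1M].
have [tu tuM tuS] := noethU _ (submodule_preim g subM).
exists (t1 ++ map g tu) => [x|x Mx].
  by rewrite mem_cat => /orP[/t1M //|/mapP[u /tuM Mu ->]].
have [x' t1x' fx'] : exists2 x', span_of (fun y => y \in t1) x' & f x' = f x.
  have exz : exists2 z, M z & f z = f x by exists x.
  apply: (twS _ exz
    (fun y => exists2 x', span_of (fun y => y \in t1) x' & f x' = y)) => [|y].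
    split.
      by exists 0; rewrite ?linear0; case: (span_of_submodule (fun y => y \in t1)).
    move=> a _ _ [y sy <-] [z sz <-]; exists (a *: y + z); rewrite ?linearP //.
    by case: (span_of_submodule (fun y => y \in t1)) => _; apply.
  by rewrite -ft1 => /mapP[z zt ->]; exists z => //; apply: span_of_gen.
have [|b gb] := ker_f (x - x'); first by rewrite linearB fx' subrr.
rewrite -[x](subrK x') -gb; apply: submoduleD (span_of_submodule _) _ _ _ _.
  have Mgb : M (g b).
    by rewrite gb; apply: submoduleB => //; apply: t1x'.
  apply: (tuS b Mgb (fun b => span_of _ (g b))) => [|u utu].
    by apply: submodule_preim; apply: span_of_submodule.
  by apply: span_of_gen; rewrite mem_cat map_f ?orbT.
by apply: span_of_mono t1x' => y yt; rewrite mem_cat yt.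
Qed.

Lemma noetherian_rV r :
  noetherian_module R^o -> noetherian_module ('rV[R]_r : lmodType R).
Proof.
move=> noethR; elim: r => [|r IH].
  move=> M [M0 _]; exists [::] => // x _ A [A0 _] _.
  by rewrite [x](_ : _ = 0) //; apply/rowP=> -[].
(* The first coordinate and the inclusion of the other [r] coordinates form the extension used in
   the inductive step. *)
have lf : linear (fun v : 'rV[R]_(1 + r) => v 0 0 : R^o) by move=> a u v; rewrite !mxE.
have lg : linear (fun v : 'rV[R]_r => row_mx 0 v : 'rV[R]_(1 + r)).
  by move=> a u v; rewrite scale_row_mx add_row_mx scaler0 addr0.
apply: (noetherian_extension (g := mk_linear lg) (f := mk_linear lf)) => //.
move=> v /= v0; exists (@rsubmx _ 1 1 r v); rewrite /= -[RHS](@hsubmxK _ 1 1 r).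
congr row_mx; apply/rowP=> i; rewrite [i]ord1 !mxE -v0; congr (v _ _).
by apply: val_inj.
Qed.

End Noetherian.

(** * Noetherianity of polynomial rings *)

Lemma noetherian_field (K : fieldType) : noetherian_module (K^o : lmodType K).
Proof.
move=> M subM; case: (excluded_middle_informative (exists2 x, M x & x != 0)).
  case=> x Mx x0; exists [:: x] => y; first by rewrite inE => /eqP ->.
  move=> _; rewrite -[y](divfK x0).
  apply: (submoduleZ (span_of_submodule _) (y / x)).
  by apply: span_of_gen; rewrite inE.
move=> noM; exists [::] => // x Mx A [A0 _] _.
by have [->|x0] := eqVneq x 0 => //; case: noM; exists x.
Qed.

Lemma noetherian_surj (R R' : comNzRingType) (f : {rmorphism R -> R'}) :
  (forall y, exists x, f x = y) ->
  noetherian_module (R^o : lmodType R) -> noetherian_module (R'^o : lmodType R').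
Proof.
move=> surj noethR M subM.
have [|t tM tS] := noethR (fun x => M (f x)).
  split=> [|a x y Mx My]; first by rewrite rmorph0; case: subM.
  by rewrite rmorphD rmorphM; case: subM => _; apply.
exists (map f t) => [_ /mapP[x /tM Mx ->] //|y].
have [x <- Mfx] := surj y.
apply: (tS x Mfx (fun x => span_of _ (f x : R'^o))) => [|z zt]; last first.
  by apply: span_of_gen; apply: map_f.
have [S0 Sl] := span_of_submodule (fun z : R'^o => z \in map f t).
split=> [|a u v Su Sv]; first by rewrite rmorph0.
by rewrite rmorphD rmorphM; apply: Sl.
Qed.

(* Otherwise pick p_k of least degree outside the span of p_0, ..., p_(k-1);
   the ideals of leading coefficients stop growing at some N, and then p_N can
   be reduced to lower degree by its predecessors. *)
Theorem hilbert_basis (R : comNzRingType) :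
  noetherian_module (R^o : lmodType R) ->
  noetherian_module ({poly R}^o : lmodType {poly R}).
Proof.
move=> noethR M subM; apply: NNPP => notfg.
pose sp (s : seq {poly R}) := @span_of {poly R} {poly R}^o (fun y => y \in s).
pose good s p := [/\ M p, ~ sp s p
  & forall q, M q -> ~ sp s q -> (size p <= size q)%N].
have next s : (forall x, x \in s -> M x) -> exists p, good s p.
  move=> sM.
  have [p Mp nsp] : exists2 p, M p & ~ sp s p.
    apply: NNPP => no; apply: notfg; exists s => // x Mx.
    by apply: NNPP => nsx; apply: no; exists x.
  have [n] := ubnP (size p); elim: n p Mp nsp => // n IH p Mp nsp lt_pn.
  case: (classic (exists2 q, M q /\ ~ sp s q & (size q < size p)%N)).
    by case=> q [Mq nsq] lt_qp; apply: (IH q) => //; apply: leq_trans lt_qp _.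
  move=> no; exists p; split=> // q Mq nsq; rewrite leqNgt.
  by apply/negP=> lt_qp; apply: no; exists q.
have [s s0 sS] : exists2 s : nat -> seq {poly R}, s 0%N = [::]
    & forall k, exists2 p, s k.+1 = rcons (s k) p & good (s k) p.
  apply: (@dependent_choice_nat (fun=> seq {poly R})
    (fun _ s => forall x, x \in s -> M x)
    (fun _ s s' => exists2 p, s' = rcons s p & good s p)) => // i s sM.
  have [p gp] := next s sM; exists (rcons s p); first by exists p.
  by move=> x; rewrite mem_rcons inE => /predU1P[->|/sM]; first by case: gp.
have s_mono i j : (i <= j)%N -> {subset s i <= s j}.
  elim: j => [|j IH]; first by rewrite leqn0 => /eqP ->.
  rewrite leq_eqVlt => /predU1P[-> //|/IH sub] x /sub xs.
  by have [p -> _] := sS j; rewrite mem_rcons inE xs orbT.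
have sM k x : x \in s k -> M x.
  elim: k => [|k IH]; first by rewrite s0.
  have [p -> [Mp _ _]] := sS k.
  by rewrite mem_rcons inE => /predU1P[->|/IH].
(* [L k] is the ideal generated by the leading coefficients of the first k chosen polynomials. *)
pose lc k (a : R) := exists2 p, p \in s k & a = lead_coef p.
pose L k := @span_of R R^o (lc k).
have L_mono i j a : (i <= j)%N -> L i a -> L j a.
  move=> le_ij; apply: span_of_mono => _ [p ps ->]; exists p => //.
  exact: s_mono ps.
have [|t tL tS] := noethR (fun a => exists k, L k a).
  split=> [|a x y [i Lx] [j Ly]].
    by exists 0%N; case: (span_of_submodule (lc 0%N : R^o -> Prop)).
  exists (maxn i j); case: (span_of_submodule (lc (maxn i j) : R^o -> Prop)) => _.
  by apply; [apply: L_mono Lx|apply: L_mono Ly]; rewrite ?leq_maxl ?leq_maxr.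
have [n tn] : exists n, forall a, a \in t -> L n a.
  elim: t tL {tS} => [|a t IH] tL; first by exists 0%N.
  have [b bt|n tn] := IH; first by apply: tL; rewrite inE bt orbT.
  have [|k Lk] := tL a; first by rewrite inE eqxx.
  exists (maxn n k) => b; rewrite inE => /predU1P[->|/tn Lb].
    by apply: L_mono Lk; rewrite leq_maxr.
  by apply: L_mono Lb; rewrite leq_maxl.
have [p sE [Mp nsp minp]] := sS n.
have Lp : L n (lead_coef p).
  have /tS : exists k, L k (lead_coef p).
    exists n.+1; apply: span_of_gen; exists p => //.
    by rewrite sE mem_rcons inE eqxx.
  by move/(_ (L n)); apply=> //; apply: span_of_submodule.
have [sp0 spl] := span_of_submodule (fun y : {poly R}^o => y \in s n).
(* Earlier choices are no larger than [p], because [p] was already a candidate when each of them was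
   chosen of least size. *)
have s_size q : q \in s n -> (size q <= size p)%N.
  have gen k : (k <= n)%N -> q \in s k -> (size q <= size p)%N.
    elim: k => [|k IH] le_kn; first by rewrite s0.
    have [r -> [_ nsr minr]] := sS k; rewrite mem_rcons inE => /predU1P[->|]; last first.
      by apply: IH; apply: ltnW.
    apply: minr => // skp; apply: nsp; apply: span_of_mono skp => y.
    by apply: s_mono; apply: ltnW.
  exact: gen.
have p0 : (0 < size p)%N.
  by rewrite size_poly_gt0; apply/eqP=> p0; apply: nsp; rewrite p0.
have [q [sq szq qp]] : exists q, [/\ sp (s n) q, (size q <= size p)%N
    & q`_(size p).-1 = lead_coef p].
  apply: (Lp (fun a => exists q, [/\ sp (s n) q, (size q <= size p)%N
    & q`_(size p).-1 = a])) => [|_ [r rs ->]].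
    split; first by exists 0; rewrite size_poly0 coef0.
    move=> a _ _ [f [sf szf <-]] [g [sg szg <-]]; exists (a%:P * f + g).
    split; first exact: spl.
      rewrite (leq_trans (size_polyD _ _)) // geq_max szg andbT mul_polyC.
      by rewrite (leq_trans (size_scale_leq _ _)).
    by rewrite coefD coefCM.
  (* The shift moves the leading coefficient of [r] to the index of the leading coefficient of
     [p]. *)
  exists ('X^(size p - size r) * r).
  have [->|r0] := eqVneq r 0.
    by rewrite mulr0 size_poly0 coef0 lead_coef0.
  split.
  - by apply: (submoduleZ (span_of_submodule _) _ (span_of_gen _)).
  - rewrite mulrC size_mulXn // subnK //; exact: s_size.
  - rewrite coefXnM ltnNge (_ : (_ <= _)%N); last first.
      by rewrite -subn1 leq_sub2l // size_poly_gt0.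
    rewrite /= lead_coefE; congr (_`_ _).
    have := s_size _ rs; move: p0; rewrite -(size_poly_gt0 r) in r0.
    by case: (size p) (size r) r0 => [|a] [|b] // _ _ le; rewrite subSS /= subKn.
have pq : ~ sp (s n) (p - q).
  move=> spq; apply: nsp; rewrite -[p](subrK q).
  exact: (submoduleD (span_of_submodule _)).
(* [p - q] is still outside the span but has lost its top coefficient, against the choice of [p] as
   smallest. *)
have : (size p <= size (p - q)%R)%N.
  apply: (minp _ _ pq); apply: (submoduleB subM) => //.
  by apply: sq => // y ys; apply: sM ys.
apply/negP; rewrite -ltnNge -(prednK p0) ltnS; apply/leq_sizeP=> j.
rewrite leq_eqVlt => /predU1P[<-|]; first by rewrite coefB qp subrr.
rewrite (prednK p0) => le_pj; rewrite coefB !nth_default ?subrr //.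
exact: leq_trans le_pj.
Qed.

(** The ring in [N.+1] variables is the image of the univariate polynomials over the ring in [N]
    variables, the new variable going to ['X_ord_max]. *)
Lemma noetherian_mpoly (K : fieldType) (N : nat) :
  noetherian_module ({mpoly K[N]}^o : lmodType {mpoly K[N]}).
Proof.
elim: N => [|N IH].
  apply: (@noetherian_surj K {mpoly K[0]} (@mpolyC 0 K) _ (@noetherian_field K)) => p.
  by exists p@_0%MM; exact: esym (nvar0_mpolyC p).
have cf : commr_rmorph (@mwiden N K) ('X_ord_max : {mpoly K[N.+1]}).
  by move=> p; apply: mulrC.
apply: (@noetherian_surj _ {mpoly K[N.+1]} (horner_morph cf) _ (hilbert_basis IH)).
elim/mpoly_ring_ind=> [c|i|_ _ [p <-] [q <-]|_ _ [p <-] [q <-]].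
- by exists c%:MP%:P; apply: etrans (horner_morphC cf _) _; rewrite /= mwidenC.
- have [j ->|->] := unliftP ord_max i; last by exists 'X; apply: horner_morphX.
  exists ('X_j)%:P; apply: etrans (horner_morphC cf _) _.
  rewrite /= mwidenX mnmwiden1; congr ('X_[U_(_)]).
  by apply: val_inj; rewrite /= /bump leqNgt ltn_ord.
- by exists (p + q); rewrite rmorphD.
- by exists (p * q); rewrite rmorphM.
Qed.

(** * Existence of minimal resolutions *)

Section MinimalResolution.
Variables (K : fieldType) (N : nat).
Local Notation S := {mpoly K[N]}.

Lemma gpart_decomposition r (d : 'I_r -> nat) (v : 'rV[S]_r) :
  exists B, v = \sum_(e < B) gpart (fun=> e : nat) d v.
Proof.
(* [msize] is one more than the degree, so this bound lies strictly above the shifted degree of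
   every monomial in [v]. *)
exists (\max_l (d l + msize (v 0%R l)))%N; apply/rowP=> l; rewrite summxE.
set B := (\max_l _)%N.
have le_dB : (d l + msize (v 0%R l) <= B)%N by apply: (leq_bigmax l).
under eq_bigr => e _ do rewrite mxE.
rewrite -(big_mkord xpredT
  (fun e => if (d l <= e)%N then pihomog mdeg (e - d l) (v 0 l) else 0)).
have le_d : (d l <= B)%N by apply: leq_trans le_dB; apply: leq_addr.
rewrite (big_cat_nat (leq0n (d l)) le_d) /= big_nat big1 ?add0r; last first.
  by move=> e /andP[_ lt]; rewrite leqNgt lt.
rewrite -{1}[d l]add0n big_addn big_mkord.
rewrite [LHS](pihomog_partitionE (mf := mdeg) (k := (B - d l)%N)).
  by apply: eq_bigr => e _; rewrite leq_addl addnK.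
by rewrite leq_subRL.
Qed.

Lemma dhomog0_const (p : S) : p \is 0.-homog -> p = (p@_0%MM)%:MP.
Proof.
move=> hp; apply/mpolyP=> m; rewrite mcoeffC.
have [->|m0] := eqVneq m 0%MM; first by rewrite mulr1.
by rewrite mulr0; apply: (dhomog_nemf_coeff hp); rewrite mdeg_eq0.
Qed.

Lemma pihomog0_const (p : S) : pihomog mdeg 0 p = (p@_0%MM)%:MP.
Proof.
rewrite [LHS]dhomog0_const ?pihomogP //; congr (_%:MP).
have {2}-> := pihomog_partitionE (mf := mdeg) (leqnSn (msize p)).
rewrite big_ord_recl mcoeffD -[LHS]addr0; congr (_ + _).
rewrite raddf_sum big1 //= => i _.
by apply: (dhomog_nemf_coeff (pihomogP _ _ _)); rewrite mf0.
Qed.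

Definition graded_submodule r (d : 'I_r -> nat) (M : 'rV[S]_r -> Prop) : Prop :=
  submodule (M : ('rV[S]_r : lmodType S) -> Prop) /\
  forall e v, M v -> M (gpart (fun=> e) d v).

Definition generating r s (M : 'rV[S]_r -> Prop) (D : 'M[S]_(s, r)) : Prop :=
  forall v, M v <-> exists w, v = w *m D.

(** The condition on syzygies is what makes the next matrix of a resolution have entries without
    constant term. *)
Definition minimally_generating r s (M : 'rV[S]_r -> Prop) (D : 'M[S]_(s, r)) :=
  generating M D /\ forall w : 'rV_s, w *m D = 0 -> forall k, (w 0 k)@_0%MM = 0.

Lemma row_span_submodule r s (D : 'M[S]_(s, r)) :
  submodule (fun v : ('rV[S]_r : lmodType S) => exists w : 'rV_s, v = w *m D).
Proof.
split=> [|a _ _ [u ->] [v ->]]; first by exists 0; rewrite mul0mx.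
by exists (a *: u + v); rewrite mulmxDl -scalemxAl.
Qed.

(** Noetherianity gives finitely many generators; their homogeneous components still lie in [M] and
    generate it. *)
Lemma homogeneous_generators r (d : 'I_r -> nat) M :
  graded_submodule d M ->
  exists s (d' : 'I_s -> nat) (D : 'M[S]_(s, r)), hom_mx d' d D /\ generating M D.
Proof.
case=> subM grM.
have [t tM tS] := @noetherian_rV _ r (@noetherian_mpoly K N) M subM.
pose sp (u : seq (nat * 'rV[S]_r)) :=
  @span_of _ ('rV[S]_r : lmodType S) (fun y => y \in unzip2 u).
have [u uM uS] : exists2 u : seq (nat * 'rV[S]_r),
    forall p, p \in u -> M p.2 /\ gpart (fun=> p.1) d p.2 = p.2
    & forall x, x \in t -> sp u x.
  elim: t {tS} tM => [|x t IH] tM; first by exists [::].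
  have [y yt|u uM uS] := IH; first by apply: tM; rewrite inE yt orbT.
  have Mx : M x by apply: tM; rewrite inE eqxx.
  have [B xE] := gpart_decomposition d x.
  exists ([seq (e, gpart (fun=> e) d x) | e <- iota 0 B] ++ u).
    move=> p; rewrite mem_cat => /orP[/mapP[e _ ->]|/uM //]; split=> /=.
      exact: grM.
    by rewrite gpart_id //; apply: hom_gpart.
  move=> y; rewrite inE => /predU1P[->|/uS].
    rewrite [X in sp _ X]xE; apply: (submodule_sum (span_of_submodule _)) => e _.
    apply: span_of_gen; rewrite /unzip2 map_cat -map_comp mem_cat; apply/orP; left.
    by apply/mapP; exists (e : nat); rewrite ?mem_iota ?ltn_ord.
  apply: span_of_mono => z; rewrite /unzip2 map_cat mem_cat => ->.
  by rewrite orbT.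
pose D : 'M[S]_(size u, r) := \matrix_(i, j) (nth (0%N, 0) u i).2 0 j.
have rowD i : row i D = (nth (0%N, 0) u i).2 by apply/rowP=> j; rewrite !mxE.
exists (size u), (fun i => (nth (0%N, 0) u i).1), D; split.
  move=> i j; have [_] := uM _ (mem_nth (0%N, 0) (ltn_ord i)).
  rewrite mxE => <-; exact: hom_gpart.
move=> v; split=> [/tS vt|[w ->]].
  apply: (vt (fun v => exists w : 'rV_(size u), v = w *m D)).
    exact: row_span_submodule.
  move=> x /uS xu; apply: (xu _ (row_span_submodule D)) => y yu.
  have iu : (index y (unzip2 u) < size u)%N by rewrite -(size_map snd u) index_mem.
  exists (delta_mx 0 (Ordinal iu)); rewrite -rowE rowD /=.
  by rewrite -(nth_map _ 0) // nth_index.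
rewrite mulmx_sum_row; apply: (submodule_sum subM) => i _.
apply: (submoduleZ subM); rewrite rowD.
by have [] := uM _ (mem_nth (0%N, 0) (ltn_ord i)).
Qed.

(* A relation whose coefficient at [k] has a nonzero constant term has, in
   degree [d' k], a homogeneous component whose [k]-th coefficient is a unit, so
   that the generator [k] is redundant. *)
Lemma minimal_homogeneous_generators r (d : 'I_r -> nat) M :
  graded_submodule d M ->
  exists s (d' : 'I_s -> nat) (D : 'M[S]_(s, r)),
    hom_mx d' d D /\ minimally_generating M D.
Proof.
move=> /homogeneous_generators[s]; elim: s => [|s IH] [d' [D [homD genD]]].
  by exists 0%N, d', D; split=> //; split=> // w _ [].
case: (classic (forall w : 'rV_s.+1, w *m D = 0 -> forall k, (w 0 k)@_0%MM = 0)).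
  by move=> minD; exists s.+1, d', D.
move=> H; have [w nw] := not_all_ex_not _ _ H.
have [wD nk] := imply_to_and _ _ nw.
have [k /eqP wk] := not_all_ex_not _ _ nk.
pose c := (w 0 k)@_0%MM; pose w' := gpart (fun=> d' k) d' w.
have w'D : w' *m D = 0 by rewrite -(gpart_mulr _ _ homD) wD raddf0.
have w'k : w' 0 k = c%:MP by rewrite mxE leqnn subnn pihomog0_const.
clearbody w'.
apply: IH; exists (d' \o lift k), (row' k D); split.
  by move=> i j; rewrite mxE; apply: homD.
move=> v; rewrite genD; split=> [[u ->]|[u ->]].
  pose u' := u - (u 0 k * c^-1%:MP) *: w'.
  have u'D : u' *m D = u *m D by rewrite mulmxBl -scalemxAl w'D scaler0 subr0.
  have u'k : u' 0 k = 0.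
    by rewrite /u' !mxE w'k -mulrA -mpolyCM mulVf // mulr1 subrr.
  exists (col' k u'); rewrite -u'D !mulmx_sum_row (bigD1_ord k) //= u'k scale0r add0r.
  by apply: eq_bigr => i _; apply/rowP=> j; rewrite !mxE.
exists (\row_i oapp (u 0) 0 (unlift k i)).
rewrite !mulmx_sum_row (bigD1_ord k) //= mxE unlift_none /= scale0r add0r.
by apply: eq_bigr => i _; apply/rowP=> j; rewrite !mxE liftK.
Qed.

Lemma syzygies_graded r s (d : 'I_r -> nat) (d' : 'I_s -> nat) (D : 'M[S]_(s, r)) :
  hom_mx d' d D -> graded_submodule d' (fun v => v *m D = 0).
Proof.
move=> homD; split=> [|e v vD].
  split=> [|a x y xD yD]; first by rewrite mul0mx.
  by rewrite mulmxDl -scalemxAl xD yD scaler0 addr0.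
by rewrite -(gpart_mulr _ _ homD) vD raddf0.
Qed.

(** Bundling a differential with its degrees and its minimality lets the resolution be built by
    plain recursion on the homological index. *)
Record syzygy_step := SyzygyStep {
  st_tgt : nat;
  st_src : nat;
  st_tgt_deg : 'I_st_tgt -> nat;
  st_src_deg : 'I_st_src -> nat;
  st_mx : 'M[S]_(st_src, st_tgt);
  st_hom : hom_mx st_src_deg st_tgt_deg st_mx;
  st_min : forall w : 'rV_st_src, w *m st_mx = 0 -> forall k, (w 0 k)@_0%MM = 0
}.

Lemma next_step_ex (x : syzygy_step) :
  exists s (d' : 'I_s -> nat) (D : 'M[S]_(s, st_src x)),
    hom_mx d' (@st_src_deg x) D /\
    minimally_generating (fun v => v *m st_mx x = 0) D.
Proof. exact/minimal_homogeneous_generators/syzygies_graded/st_hom. Qed.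

Lemma next_stepP (x : syzygy_step) :
  {s : nat & {d' : 'I_s -> nat & {D : 'M[S]_(s, st_src x) |
    hom_mx d' (@st_src_deg x) D /\
    minimally_generating (fun v => v *m st_mx x = 0) D}}}.
Proof.
have /constructive_indefinite_description[s] := next_step_ex x.
move=> /constructive_indefinite_description[d'].
by move=> /constructive_indefinite_description[D DP]; exists s, d', D.
Qed.

(** The target rank of the new step is convertible to [st_src x], so consecutive matrices compose
    without casts. *)
Definition next_step (x : syzygy_step) : syzygy_step :=
  SyzygyStep (proj1 (projT2 (projT2 (projT2 (next_stepP x)))))
             (proj2 (proj2 (projT2 (projT2 (projT2 (next_stepP x)))))).

Lemma next_step_gen (x : syzygy_step) :
  generating (fun v => v *m st_mx x = 0) (st_mx (next_step x)).
Proof. exact: (proj1 (proj2 (projT2 (projT2 (projT2 (next_stepP x)))))). Qed.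

Lemma next_step_hom (x : syzygy_step) :
  hom_mx (@st_src_deg (next_step x)) (@st_src_deg x)
    (st_mx (next_step x) : 'M_(_, st_src x)).
Proof. exact: st_hom (next_step x). Qed.

Lemma next_step_const (x : syzygy_step) i (j : 'I_(st_src x)) :
  (st_mx (next_step x) i j)@_0%MM = 0.
Proof.
have : row i (st_mx (next_step x) : 'M_(_, st_src x)) *m st_mx x = 0.
  by apply/next_step_gen; exists (delta_mx 0 i); rewrite rowE.
by move/(st_min (s := x))/(_ j); rewrite mxE.
Qed.

End MinimalResolution.

Section Existence.
Variables (K : fieldType) (N : nat).
Local Notation S := {mpoly K[N]}.

Definition homogeneous_ideal (I : S -> Prop) : Prop :=
  [/\ I 0, forall a f g, I f -> I g -> I (a * f + g)
    & forall e f, I f -> I (pihomog mdeg e f)].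

Lemma minimal_resolution_exists (I : S -> Prop) :
  homogeneous_ideal I ->
  exists F : graded_free_data K N, minimal_graded_free_resolution I F.
Proof.
case=> I0 Il Ih.
have [|s [d' [D [homD [genD minD]]]]] :=
  @minimal_homogeneous_generators K N 1 (fun=> 0%N) (fun v => I (v 0 0)).
  split; first by split=> [|a x y]; rewrite !mxE //; apply: Il.
  by move=> e v Iv; rewrite mxE subn0; apply: Ih.
pose x0 := SyzygyStep homD minD.
pose st := fix st i := if i is j.+1 then next_step (st j) else x0.
exists (GradedFreeData (gf_rank := fun i => st_src (st i))
  (fun i => @st_src_deg _ _ (st i))
  (fun i => st_mx (next_step (st i)) : 'M_(_, st_src (st i))) D).
split.
- split=> [k|i]; last exact: (next_step_hom (x := st i)).
  have [D0|/homD[e dk he]] := eqVneq (D k 0) 0; last by rewrite /= dk.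
  by rewrite /= D0 dhomog0.
- split=> [f|v|i v].
  + have := genD f%:M; rewrite mxE eqxx mulr1n => ->.
    by split=> -[w wE]; exists w.
  + exact: (next_step_gen (x := x0) v).
  + exact: (next_step_gen (x := st i.+1) v).
by move=> i k l; exact: (next_step_const (x := st i)).
Qed.

End Existence.

(** * Mapping cones *)

Section Cone.
Variables (K : fieldType) (N : nat).
Local Notation S := {mpoly K[N]}.
Variables (F : graded_free_data K N) (f : S) (e : nat).

(* C_i = E_(i+1) + E_i(-e) for the augmented complex E of F. *)
Definition cone_rank i := (aug_rank F i.+1 + aug_rank F i)%N.

Definition cone_deg i (k : 'I_(cone_rank i)) : nat :=
  match split k with
  | inl a => @aug_deg _ _ F i.+1 a
  | inr b => (@aug_deg _ _ F i b + e)%N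
  end.

(** This is the cone of multiplication by [f] from E(-e) to E; the sign makes consecutive
    differentials compose to zero. As E_0 = S, the generators in degree 0 are those of F together
    with one for [f]. *)
Definition mapping_cone : graded_free_data K N :=
  @GradedFreeData K N cone_rank cone_deg
    (fun i => block_mx (aug_diff F i.+1) 0 f%:M (- aug_diff F i))
    (col_mx (aug_diff F 0) f%:M).

Variables (I : S -> Prop).
Hypotheses (resF : minimal_graded_free_resolution I F).
Hypotheses (homf : f \is e.-homog) (e_gt0 : (0 < e)%N).
Hypothesis I_const : forall g, I g -> g@_0%MM = 0.
Hypothesis f_regular : forall g, I (f * g) -> I g.

(** For [gf_aug] the claim comes from [I_const], since its entries belong to [I]. *)
Lemma aug_diff_const i k l : (aug_diff F i k l)@_0%MM = 0.
Proof.
have [_ exF minF] := resF; case: i k l => [|i] k l; last exact: minF.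
apply: I_const; rewrite [l]ord1; apply/(aug_diff_im _ exF).
by exists (delta_mx 0 k); rewrite -rowE; apply/rowP=> j; rewrite [j]ord1 !mxE.
Qed.

(* At E_0 = S there is no cycle condition on b: regularity of f replaces it. *)
Lemma cone_exact i (a : 'rV_(aug_rank F i.+1)) (b : 'rV_(aug_rank F i)) :
  a *m aug_diff F i + f *: b = 0 ->
  (if i is j.+1 then fun b : 'rV_(aug_rank F j.+1) => b *m aug_diff F j = 0
   else fun=> True) b ->
  exists w, row_mx a b = w *m
    block_mx (aug_diff F i.+1) 0 f%:M (- aug_diff F i).
Proof.
have [_ exF _] := resF => ab0 b0.
have [w bE] : exists w, b = w *m aug_diff F i.
  case: i b a ab0 b0 => [|i] b a ab0 b0; last exact/(aug_diff_exact _ exF).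
  have : I (b 0 0).
    apply: f_regular; apply/(aug_diff_im _ exF); exists (- a).
    rewrite mulNmx -[LHS](addKr (a *m aug_diff F 0)).
    by rewrite -scale_scalar_mx -mx11_scalar ab0 addr0.
  by move/(aug_diff_im _ exF); rewrite -mx11_scalar.
(* Substituting b = w D into the cycle condition makes a + f w a cycle, hence a boundary w' D'; the
   preimage is then (w', -w). *)
have /(aug_diff_exact _ exF)[w' w'E] : (a + f *: w) *m aug_diff F i = 0.
  by rewrite mulmxDl -scalemxAl -bE.
exists (row_mx w' (- w)); rewrite mul_row_block mulmx0 add0r !mulNmx mulmxN opprK.
by rewrite -w'E bE mul_mx_scalar addrK.
Qed.

Lemma mapping_cone_resolution J :
  (forall g, J g <-> exists a c, I a /\ g = a + c * f) ->
  minimal_graded_free_resolution J mapping_cone.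
Proof.
move=> JE; have [homF exF minF] := resF.
(* Positive degree keeps constants out of the block [f%:M], so the cone stays minimal. *)
have fI0 : f@_0%MM = 0 by apply: (dhomog_nemf_coeff homf); rewrite mf0; case: e e_gt0.
split.
- split=> [k|i k l] /=.
    rewrite /cone_deg mxE; case: splitP => a _.
      exact: (proj1 homF).
    by rewrite [a]ord1 mxE eqxx.
  rewrite /cone_deg !mxE; case: splitP => a _; rewrite !mxE; case: splitP => b _.
  + exact: aug_diff_hom.
  + by rewrite mxE eqxx.
  + rewrite mxE; have [->|ab] := eqVneq a b; last by rewrite eqxx.
    by rewrite mulr1n => _; exists e.
  + rewrite mxE oppr_eq0 => /(aug_diff_hom homF)[c dE hc].
    by exists c; rewrite ?dhomogN // dE addnAC.
- split=> [g|v|i v] /=.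
  + rewrite JE; split=> [[a [c [/(aug_diff_im _ exF)[v vE] ->]]]|[v]].
      exists (row_mx v c%:M); rewrite mul_row_col -vE raddfD /=.
      by rewrite -scalar_mxM.
    rewrite -[v]hsubmxK mul_row_col => vE.
    exists ((lsubmx v *m aug_diff F 0) 0 0), (rsubmx v 0 0); split.
      by apply/(aug_diff_im _ exF); exists (lsubmx v); rewrite -mx11_scalar.
    have := congr1 (fun M : 'M_1 => M 0 0) vE.
    by rewrite mul_mx_scalar mxE eqxx mulr1n [RHS]mxE [X in _ + X]mxE mulrC.
  + rewrite -[v]hsubmxK mul_row_col mul_mx_scalar; split=> [ab0|].
      exact: (cone_exact (i := 0)).
    case=> w; rewrite -[w]hsubmxK mul_row_block mulmx0 add0r => /eq_row_mx[-> ->].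
    rewrite mulmxDl -mulmxA (aug_diffK _ exF) mulmx0 add0r.
    by rewrite mul_mx_scalar mulmxN -scalemxAl scalerN subrr.
  + rewrite -[v]hsubmxK mul_row_block mulmx0 add0r mul_mx_scalar mulmxN.
    split=> [/eqP|].
      rewrite -row_mx0 => /eqP/eq_row_mx[ab0 /eqP]; rewrite oppr_eq0 => /eqP b0.
      exact: (cone_exact (i := i.+1)).
    case=> w; rewrite -[w]hsubmxK mul_row_block mulmx0 add0r => /eq_row_mx[-> ->].
    rewrite mulmxDl -mulmxA (aug_diffK _ exF) mulmx0 add0r.
    rewrite mul_mx_scalar mulmxN mulNmx -mulmxA (aug_diffK _ exF) mulmx0 oppr0.
    by rewrite -scalemxAl scalerN subrr oppr0 row_mx0.
- move=> i k l /=; rewrite !mxE; case: splitP => a _; rewrite !mxE.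
    by case: splitP => b _; rewrite ?mxE ?mcoeff0 //; apply: aug_diff_const.
  case: splitP => b _; rewrite mxE; last by rewrite mcoeffN aug_diff_const oppr0.
  by case: eqP; rewrite ?mulr1n // mulr0n mcoeff0.
Qed.

End Cone.

(** * Binomial edge ideals *)

Section BinomialEdgeIdeal.
Variables (K : fieldType) (n : nat).
Local Notation S := {mpoly K[n + n]}.
Local Notation b := (edge_binomial K).
Local Notation J G := (@binomial_edge_ideal K n G).
Implicit Types (G : rel 'I_n).

Lemma edge_binomialC (i j : 'I_n) : b j i = - b i j.
Proof. by rewrite /edge_binomial opprB. Qed.

Lemma edge_binomial_homog (i j : 'I_n) : b i j \is 2.-homog.
Proof.
have hX k l : ('X_k * 'X_l : S) \is 2.-homog.
  by apply: (@dhomogM _ _ mdeg 1 _ 1); rewrite dhomogX /= mdeg1.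
by rewrite /edge_binomial rpredB ?hX.
Qed.

Lemma bei0 G : J G 0.
Proof.
by exists (fun _ _ => 0); rewrite big1 // => i _; rewrite big1 // => j _; rewrite mul0r.
Qed.

Lemma bei_linear G a f g : J G f -> J G g -> J G (a * f + g).
Proof.
move=> [c ->] [d ->]; exists (fun i j => a * c i j + d i j).
rewrite mulr_sumr -big_split; apply: eq_bigr => i _ /=.
rewrite mulr_sumr -big_split; apply: eq_bigr => j _ /=.
by rewrite mulrDl mulrA.
Qed.

Lemma beiM G a f : J G f -> J G (a * f).
Proof. by move=> Jf; rewrite -[_ * _]addr0; apply/bei_linear/bei0. Qed.

Lemma beiD G f g : J G f -> J G g -> J G (f + g).
Proof. by move=> Jf Jg; rewrite -[f]mul1r; apply: bei_linear. Qed.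

Lemma beiN G f : J G f -> J G (- f).
Proof. by rewrite -mulN1r; apply: beiM. Qed.

Lemma beiB G f g : J G f -> J G g -> J G (f - g).
Proof. by move=> Jf Jg; apply/beiD/beiN. Qed.

Lemma bei_gen G i j : ssrbool.symmetric G -> G i j -> J G (b i j).
Proof.
move=> symG.
wlog lt_ij : i j / (i < j)%N.
  move=> IH Gij; have [lt_ij|lt_ji|/val_inj ->] := ltngtP i j.
  - exact: IH.
  - by rewrite edge_binomialC; apply/beiN/IH; rewrite // symG.
  - by rewrite /edge_binomial subrr; apply: bei0.
move=> Gij; exists (fun k l => ((k == i) && (l == j))%:R).
rewrite (bigD1 i) //= (bigD1 j) ?lt_ij ?Gij //= !eqxx mul1r.
rewrite big1 ?big1 ?addr0 // => [k /negPf ->|l /andP[_ /negPf ->]].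
  by rewrite big1 // => l _; rewrite mul0r.
by rewrite andbF mul0r.
Qed.

(** The induction principle for J_G: a property that defines an ideal need only be checked on edge
    binomials. *)
Lemma bei_least G (I : S -> Prop) :
  I 0 -> (forall a f g, I f -> I g -> I (a * f + g)) ->
  (forall i j, G i j -> I (b i j)) -> forall f, J G f -> I f.
Proof.
move=> I0 Il Ib f [c ->].
have ID x y : I x -> I y -> I (x + y) by move=> Ix Iy; rewrite -[x]mul1r; apply: Il.
apply: (big_ind I) => // i _; apply: (big_ind I) => // j /andP[_ Gij].
by rewrite -[_ * _]addr0; apply: Il => //; apply: Ib.
Qed.

Lemma bei_mono G G' : ssrbool.symmetric G' -> subrel G G' -> forall f, J G f -> J G' f.
Proof.
move=> symG' sub; apply: (@bei_least _ (J G')) => [|a f g|i j /sub Gij].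
- exact: bei0.
- exact: bei_linear.
- exact: bei_gen.
Qed.

Lemma bei_const G f : J G f -> f@_0%MM = 0.
Proof.
move: f; apply: (@bei_least _ (fun f => f@_0%MM = 0)) => [|a f g f0 g0|i j _].
- by rewrite mcoeff0.
- by rewrite rmorphD rmorphM /= f0 g0 mulr0 addr0.
- by apply: (dhomog_nemf_coeff (edge_binomial_homog i j)); rewrite mf0.
Qed.

(** A form of freeness that avoids maximal cliques and is easily followed through [complete_at] and
    [isolate]. *)
Definition simplicial G (w : 'I_n) : bool :=
  [forall x, forall y, G w x ==> G w y ==> (x != y) ==> G x y].

Lemma simplicialP G w :
  reflect (forall x y, G w x -> G w y -> x != y -> G x y) (simplicial G w).
Proof.
apply: (iffP 'forall_forallP) => H x y; last first.
  by apply/implyP=> Gx; apply/implyP=> Gy; apply/implyP=> ne; apply: H.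
by move=> Gx Gy ne; have := H x y; rewrite Gx Gy ne.
Qed.

(** * Disjoint unions of cliques *)

Section DisjointCliques.
Variable G : rel 'I_n.
Hypothesis symG : ssrbool.symmetric G.
Hypothesis simpG : forall w, simplicial G w.

(** On a path the second vertex is adjacent to the first and, by induction, equal or adjacent to the
    last; its neighbourhood being a clique gives the shortcut. *)
Lemma connect_clique i j : connect G i j -> (i == j) || G i j.
Proof.
case/connectP=> p; elim: p i => [|k p IH] i /=; first by move=> _ ->; rewrite eqxx.
case/andP=> Gik /IH{IH}H /H/predU1P[<-|Gkj]; first by rewrite Gik orbT.
have [//|ne /=] := eqVneq i j.
by have /simplicialP := simpG k; apply; rewrite // symG.
Qed.

Let csym : connect_sym G.
Proof. exact: sym_connect_sym. Qed.

Local Notation c := (fingraph.root G).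

(* x_i |-> a_i s_(c i) and y_i |-> a_i, where c i is the component of i *)
Definition clique_exponent (k : 'I_(n + n)) : 'X_{1..n + n} :=
  match split k with
  | inl i => (U_(lshift n i) + U_(rshift n (c i)))%MM
  | inr i => U_(lshift n i)%MM
  end.

(** The target is S again: its first n variables serve as the a_i and its last n as the s_c, with
    components named by their roots. *)
Definition clique_map : S -> S :=
  mmap (@mpolyC (n + n) K) (fun k => 'X_[clique_exponent k]).

HB.instance Definition _ := GRing.RMorphism.on clique_map.

Definition exponent_image (m : 'X_{1..n + n}) : 'X_{1..n + n} :=
  (\sum_k clique_exponent k *+ m k)%MM.

Lemma clique_exponentl i :
  clique_exponent (lshift n i) = (U_(lshift n i) + U_(rshift n (c i)))%MM.
Proof. by rewrite /clique_exponent (unsplitK (inl i)). Qed.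

Lemma clique_exponentr i : clique_exponent (rshift n i) = U_(lshift n i)%MM.
Proof. by rewrite /clique_exponent (unsplitK (inr i)). Qed.

Lemma clique_mapU k : clique_map 'X_k = 'X_[clique_exponent k].
Proof. by rewrite /clique_map mmapX mmap1U. Qed.

Lemma clique_mapX m : clique_map 'X_[m] = 'X_[exponent_image m].
Proof.
rewrite /clique_map mmapX /mmap1 /exponent_image -mprodXE.
by apply: eq_bigr => k _; rewrite mpolyXn.
Qed.

Lemma exponent_imageD m1 m2 :
  exponent_image (m1 + m2)%MM = (exponent_image m1 + exponent_image m2)%MM.
Proof.
apply/mnmP=> k; rewrite mnmDE !mnm_sumE -big_split; apply: eq_bigr => i _ /=.
by rewrite !mulmnE mnmDE mulnDr.
Qed.

Lemma exponent_imageU k : exponent_image U_(k)%MM = clique_exponent k.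
Proof.
rewrite /exponent_image (bigD1 k) //= mnm1E eqxx big1 ?addm0 // => i ne.
by rewrite mnm1E eq_sym (negPf ne).
Qed.

Lemma exponent_imagel m i :
  exponent_image m (lshift n i) = (m (lshift n i) + m (rshift n i))%N.
Proof.
rewrite mnm_sumE big_split_ord /=; congr (_ + _)%N.
  rewrite (bigD1 i) //= mulmnE clique_exponentl mnmDE !mnm1E eqxx eq_rlshift mul1n.
  rewrite big1 ?addn0 // => j ne.
  by rewrite mulmnE clique_exponentl mnmDE !mnm1E eq_rlshift eq_lshift (negPf ne).
rewrite (bigD1 i) //= mulmnE clique_exponentr mnm1E eqxx mul1n.
rewrite big1 ?addn0 // => j ne.
by rewrite mulmnE clique_exponentr mnm1E eq_lshift (negPf ne).
Qed.

Lemma exponent_imager m k :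
  exponent_image m (rshift n k) = (\sum_(i | c i == k) m (lshift n i))%N.
Proof.
rewrite mnm_sumE big_split_ord /= [X in (_ + X)%N]big1 ?addn0; last first.
  by move=> j _; rewrite mulmnE clique_exponentr mnm1E eq_lrshift.
rewrite [RHS]big_mkcond; apply: eq_bigr => j _.
rewrite mulmnE clique_exponentl mnmDE !mnm1E eq_lrshift eq_rshift add0n.
by case: eqP; rewrite ?mul1n ?mul0n.
Qed.

Lemma binomial_move i j (m : 'X_{1..n + n}) : connect G i j ->
  J G ('X_[m + U_(lshift n i) + U_(rshift n j)]
       - 'X_[m + U_(lshift n j) + U_(rshift n i)]).
Proof.
move=> /connect_clique Gij; rewrite !mpolyXD -!mulrA -mulrBr.
apply: beiM; rewrite -/(b i j).
case/predU1P: Gij => [->|]; last exact: bei_gen.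
by rewrite /edge_binomial subrr; apply: bei0.
Qed.

(* Both exponents have the same degree in each pair (x_i, y_i) and the same
   x-degree on each component, so that swaps x_i y_j -> x_j y_i inside the
   components lead from one to the other. *)
Lemma exponent_image_congr m m' :
  exponent_image m = exponent_image m' -> J G ('X_[m] - 'X_[m']).
Proof.
(* The induction is on the total excess of the x-exponents of [m] over those of [m'], a sum of
   truncated differences. *)
have [d] := ubnP (\sum_i (m (lshift n i) - m' (lshift n i)))%N.
elim: d m => // d IH m lt_d eq_im.
have eql i : (m (lshift n i) + m (rshift n i) = m' (lshift n i) + m' (rshift n i))%N.
  by rewrite -!exponent_imagel eq_im.
have eqr k : (\sum_(i | c i == k) m (lshift n i) = \sum_(i | c i == k) m' (lshift n i))%N.
  by rewrite -!exponent_imager eq_im.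
(* Without any excess, equal sums over each component force equal x-exponents, and then equal
   y-exponents. *)
case: (pickP (fun i => m' (lshift n i) < m (lshift n i))%N) => [i lt_i|le]; last first.
  rewrite [m](_ : _ = m') ?subrr; first exact: bei0.
  have le' i : (m (lshift n i) <= m' (lshift n i))%N by rewrite leqNgt le.
  have eqx i : m (lshift n i) = m' (lshift n i).
    have := leqif_sum (P := fun j => c j == c i)
      (fun j _ => conj (le' j) (erefl (m (lshift n j) == m' (lshift n j)))).
    case=> _; rewrite eqr eqxx => /esym/forall_inP/(_ i); rewrite eqxx.
    by move=> /(_ isT)/eqP.
  apply/mnmP=> k; rewrite -(splitK k); case: (split k) => i /=; first exact: eqx.
  by apply/eqP; rewrite -(eqn_add2l (m (lshift n i))) eql eqx.
(* An excess at [i] must be balanced by a deficit in the same component. *)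
have [j cj lt_j] : exists2 j, c j == c i & (m (lshift n j) < m' (lshift n j))%N.
  apply/exists_inP; rewrite -[X in is_true X]negbK negb_exists_in.
  apply/negP=> /forall_inP no; have := eqr (c i); apply/eqP.
  rewrite gtn_eqF // (bigD1 i) // [X in (_ < X)%N](bigD1 i) //= -addSn leq_add //.
  by apply: leq_sum => k /andP[ck _]; rewrite leqNgt; apply: no.
have ne_ij : i != j.
  by apply/eqP=> eq_ij; move: lt_i lt_j; rewrite eq_ij ltnNge => /negP H /ltnW.
have mi : (0 < m (lshift n i))%N by apply: leq_ltn_trans lt_i.
(* The degrees in (x_j, y_j) agree and the x_j-exponent is too small, so y_j divides the
   monomial. *)
have mj : (0 < m (rshift n j))%N.
  by rewrite -(ltn_add2l (m (lshift n j))) addn0 eql; apply: ltn_addr.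
pose m0 := (m - U_(lshift n i) - U_(rshift n j))%MM.
have mE : m = (m0 + U_(lshift n i) + U_(rshift n j))%MM.
  apply/mnmP=> k; rewrite /m0 !mnmDE !mnmBE !mnm1E.
  have [<-|_] := eqVneq (lshift n i) k; first by rewrite eq_rlshift subn0 addn0 subnK.
  by have [<-|_] := eqVneq (rshift n j) k; rewrite subn0 addn0 ?subnK ?subn0 ?addn0.
pose m1 := (m0 + U_(lshift n j) + U_(rshift n i))%MM.
rewrite -[X in J G X](_ : ('X_[m] - 'X_[m1]) + ('X_[m1] - 'X_[m']) = _); last first.
  by rewrite addrA subrK.
apply: beiD.
  rewrite {1}mE; apply: binomial_move.
  by rewrite -(root_connect csym) eq_sym.
apply: IH; last first.
  rewrite -eq_im mE /m1 !exponent_imageD !exponent_imageU.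
  rewrite !clique_exponentl !clique_exponentr (eqP cj).
  by apply/mnmP=> k; rewrite !mnmDE; ring.
(* The swap lowers the excess at [i] by one and creates none at [j], where [m] was below [m']. *)
rewrite ltnS in lt_d; apply: leq_trans lt_d.
have m1l k : m1 (lshift n k) =
    (m (lshift n k) - (i == k) + (j == k))%N.
  rewrite /m1 /m0 !mnmDE !mnmBE !mnm1E !eq_lshift !eq_rlshift.
  by rewrite subn0 addn0.
rewrite (bigD1 i) // [X in (_ < X)%N](bigD1 i) //= -addSn leq_add //.
  by rewrite m1l eqxx eq_sym (negPf ne_ij) addn0 subn1 ltn_sub2r // prednK.
apply: leq_sum => k ne_ki; rewrite m1l [i == k]eq_sym (negPf ne_ki) subn0.
case: eqP => [<-|_]; last by rewrite addn0.
by rewrite addn1 (eqP lt_j).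
Qed.

(** In a vanishing image the leading monomial [m] must share its image with another monomial [m'] of
    the support. Subtracting a multiple of the difference of the two, which lies in J_G, shrinks the
    support. *)
Lemma clique_map_ker g : clique_map g = 0 -> J G g.
Proof.
have [s] := ubnP (size (msupp g)); elim: s g => // s IH g lt_s g0.
have [->|nz] := eqVneq g 0; first exact: bei0.
pose m := mlead g.
have gm : m \in msupp g by apply: mlead_supp.
have mapE : clique_map g = \sum_(l <- msupp g) g@_l *: 'X_[exponent_image l].
  rewrite {1}[g]mpolyE raddf_sum /=; apply: eq_bigr => l _.
  by rewrite -mul_mpolyC rmorphM /= clique_mapX /clique_map mmapC mul_mpolyC.
have [m' [gm' ne eq_im]] : exists m',
    [/\ m' \in msupp g, m' != m & exponent_image m' = exponent_image m].
  case: (hasP (a := fun l => (l != m) && (exponent_image l == exponent_image m))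
    (s := msupp g)) => [[l gl /andP[ne /eqP eq_im]]|no]; first by exists l.
  have := congr1 (mcoeff (exponent_image m)) g0.
  rewrite mapE raddf_sum mcoeff0 (bigD1_seq m) ?msupp_uniq //= big1_seq.
    rewrite addr0 mcoeffZ mcoeffX eqxx mulr1 => /eqP.
    by rewrite mcoeff_eq0 gm.
  move=> l /andP[ne gl]; rewrite mcoeffZ mcoeffX; case: eqP; rewrite ?mulr0 //.
  by move=> eq_im; case: no; exists l; rewrite // ne eq_im eqxx.
pose h := g@_m *: ('X_[m] - 'X_[m']).
have Jh : J G h by rewrite /h -mul_mpolyC; apply/beiM/exponent_image_congr.
rewrite -[g](subrK h); apply: beiD => //; apply: IH.
  have sub : {subset m :: msupp (g - h) <= msupp g}.
    move=> l; rewrite inE => /predU1P[-> //|]; apply: contraLR => gl.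
    rewrite -!mcoeff_eq0 in gl *; rewrite mcoeffB (eqP gl) sub0r oppr_eq0.
    rewrite mcoeffZ mcoeffB !mcoeffX.
    have /negPf-> : m != l by apply: contraTneq gm => ->; rewrite -mcoeff_eq0.
    have /negPf-> : m' != l by apply: contraTneq gm' => ->; rewrite -mcoeff_eq0.
    by rewrite subrr mulr0.
  rewrite ltnS in lt_s; apply: leq_trans lt_s.
  apply: (uniq_leq_size _ sub); rewrite /= msupp_uniq andbT.
  rewrite -mcoeff_eq0 mcoeffB mcoeffZ mcoeffB !mcoeffX eqxx (negPf ne).
  by rewrite subr0 mulr1 subrr.
rewrite rmorphB /= g0 sub0r /h -mul_mpolyC rmorphM rmorphB /= !clique_mapX eq_im.
by rewrite subrr mulr0 oppr0.
Qed.

Lemma clique_map_edge i j : clique_map (b i j) =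
  'X_(lshift n i) * 'X_(lshift n j) * ('X_(rshift n (c i)) - 'X_(rshift n (c j))).
Proof.
rewrite rmorphB !rmorphM /= !clique_mapU !clique_exponentl !clique_exponentr.
by rewrite !mpolyXD; ring.
Qed.

(** J_G is the kernel of a map to a domain, under which f_uv has nonzero image: the variables of two
    distinct components differ. *)
Lemma disjoint_cliques_regular u v g :
  ~~ connect G u v -> J G (b u v * g) -> J G g.
Proof.
move=> nuv Jg; apply: clique_map_ker; apply/eqP.
have : clique_map (b u v * g) == 0.
  move: (b u v * g) Jg => f Jf; apply/eqP; move: f Jf.
  apply: (@bei_least _ (fun f => clique_map f = 0)) => [|a f f' f0 f'0|i j Gij].
  - exact: rmorph0.
  - by rewrite rmorphD rmorphM /= f0 f'0 mulr0 addr0.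
  - have /eqP eq_c : c i == c j by rewrite (root_connect csym) connect1.
    by rewrite clique_map_edge eq_c subrr mulr0.
rewrite rmorphM /= clique_map_edge !mulf_eq0 subr_eq0 => /orP[|//].
have X0 k : ('X_k == 0 :> S) = false.
  apply/negP=> /eqP/(congr1 (mcoeff U_(k)%MM))/eqP.
  by rewrite mcoeffX eqxx mcoeff0 oner_eq0.
rewrite !X0 /= => /eqP/(congr1 (mcoeff U_(rshift n (c u))%MM)).
rewrite !mcoeffX eqxx; case: eqP => [/mnmP/(_ (rshift n (c u)))|_ /eqP].
  rewrite !mnm1E eqxx eq_rshift; case: eqP => // /esym/eqP.
  by rewrite (root_connect csym) (negPf nuv).
by rewrite oner_eq0.
Qed.

End DisjointCliques.

(** * Completing a neighbourhood and isolating a vertex *)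

Section Completion.
Variables (G : rel 'I_n) (w : 'I_n).
Hypothesis symG : ssrbool.symmetric G.

Definition complete_at : rel 'I_n :=
  [rel x y | G x y || [&& x != y, x != w, y != w, G w x & G w y]].

(** The vertex [w] is isolated rather than deleted, so that the ring S stays the same. *)
Definition isolate : rel 'I_n := [rel x y | [&& G x y, x != w & y != w]].

Lemma complete_at_sym : ssrbool.symmetric complete_at.
Proof.
by move=> x y; rewrite /complete_at /= symG [x == y]eq_sym; congr (_ || (_ && _));
  rewrite [RHS]andbCA; congr (_ && (_ && _)); rewrite andbC.
Qed.

Lemma isolate_sym : ssrbool.symmetric isolate.
Proof. by move=> x y; rewrite /isolate /= symG [(x != w) && _]andbC. Qed.

(** If xy is an old edge and xz a new one, then [y] and [w] are both old neighbours of [x], hence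
    adjacent or equal. So [y] and [z] are neighbours of [w], or yz is an old edge. *)
Lemma complete_at_simplicial x : simplicial G x -> simplicial complete_at x.
Proof.
move=> /simplicialP sx; apply/simplicialP; rewrite /complete_at /= => y z Gxy Gxz ne_yz.
have [//|nGyz /=] := boolP (G y z); rewrite ne_yz /=.
have hy : G x y -> G w x -> y != w -> G w y.
  by move=> Gy Gwx yw; rewrite symG; apply: sx; rewrite // symG.
have hz : G x z -> G w x -> z != w -> G w z.
  by move=> Gz Gwx zw; rewrite symG; apply: sx; rewrite // symG.
case/orP: Gxy => [Gxy|/and5P[_ _ yw wx wy]]; case/orP: Gxz => [Gxz|/and5P[_ _ zw wx' wz]].
- by rewrite sx in nGyz.
- have yw : y != w by apply: contraNneq nGyz => ->.
  by rewrite yw zw wz hy.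
- have zw : z != w by apply: contraNneq nGyz => ->; rewrite symG.
  by rewrite yw zw wy hz.
- by rewrite yw zw wy wz.
Qed.

Lemma complete_at_simplicial_self : irreflexive G -> simplicial complete_at w.
Proof.
move=> irrG; apply/simplicialP; rewrite /complete_at => y z; rewrite /= eqxx /= !andbF !orbF.
move=> wy wz ->; rewrite wy wz !andbT; apply/orP; right=> /=.
by apply/andP; split; [apply: contraTneq wy|apply: contraTneq wz] => ->; rewrite irrG.
Qed.

Lemma isolate_simplicial x : simplicial G x -> simplicial isolate x.
Proof.
move=> /simplicialP sx; apply/simplicialP; rewrite /isolate /= => y z.
move=> /and3P[xy _ yw] /and3P[xz _ zw] ne.
by rewrite sx // yw zw.
Qed.

Lemma isolate_simplicial_self : simplicial isolate w.
Proof. by apply/simplicialP; rewrite /isolate => y z; rewrite /= eqxx /= andbF. Qed.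

Lemma complete_at_connect x y : connect complete_at x y -> connect G x y.
Proof.
apply: connect_sub => {}x {}y; rewrite /complete_at /= => /orP[/connect1 //|/and5P[_ _ _ wx wy]].
by apply: (@connect_trans _ _ w); apply: connect1; rewrite // symG.
Qed.

Lemma isolate_connect x y : connect isolate x y -> connect G x y.
Proof. by apply: connect_sub => {}x {}y; rewrite /isolate /= => /and3P[/connect1]. Qed.

(** Reduction modulo (x_w, y_w), with the quotient realised as the subring of S without these
    variables; its elements are the fixed points. *)
Definition kill_vars : S -> S :=
  mmap (@mpolyC (n + n) K)
    (fun k => if (k == lshift n w) || (k == rshift n w) then 0 else 'X_k).

HB.instance Definition _ := GRing.RMorphism.on kill_vars.

Lemma kill_varsU k :
  kill_vars 'X_k = if (k == lshift n w) || (k == rshift n w) then 0 else 'X_k.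
Proof. by rewrite /kill_vars mmapX mmap1U. Qed.

Lemma kill_vars_id a : kill_vars (kill_vars a) = kill_vars a.
Proof.
elim/mpoly_ring_ind: a => [c|k|p q IHp IHq|p q IHp IHq].
- by rewrite /kill_vars !mmapC.
- by rewrite !kill_varsU; case: ifP; rewrite ?rmorph0 // kill_varsU => ->.
- by rewrite rmorphD /= rmorphD /= IHp IHq.
- by rewrite rmorphM /= rmorphM /= IHp IHq.
Qed.

Lemma kill_vars_edge i j :
  kill_vars (b i j) = if (i == w) || (j == w) then 0 else b i j.
Proof.
rewrite rmorphB !rmorphM /= !kill_varsU !eq_lshift !eq_rshift !eq_lrshift !eq_rlshift.
by rewrite !orbF !orFb; case: (i == w); case: (j == w);
  rewrite /= ?(mul0r, mulr0, subrr).
Qed.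

Lemma kill_vars_ideal f : J G f -> J isolate (kill_vars f).
Proof.
move: f; apply: (@bei_least _ (fun f => J isolate (kill_vars f))) => [|a f g Jf Jg|i j Gij].
- by rewrite rmorph0; apply: bei0.
- by rewrite rmorphD rmorphM; apply: bei_linear.
- rewrite kill_vars_edge; case: eqP => [_|/eqP iw] /=; first exact: bei0.
  case: eqP => [_|/eqP jw]; first exact: bei0.
  by apply: bei_gen; [exact: isolate_sym|rewrite /isolate /= Gij iw jw].
Qed.

(** [a - kill_vars a] lies in (x_w, y_w). For a product, with k for [kill_vars], pq - k(p)k(q) = q(p
    - k(p)) + k(p)(q - k(q)). *)
Lemma kill_vars_diff r : J G ('X_(lshift n w) * r) -> J G ('X_(rshift n w) * r) ->
  forall a, J G ((a - kill_vars a) * r).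
Proof.
move=> Jx Jy; elim/mpoly_ring_ind => [c|k|p q Jp Jq|p q Jp Jq].
- by rewrite /kill_vars mmapC subrr mul0r; apply: bei0.
- rewrite kill_varsU; case: eqP => [->|_] /=; first by rewrite subr0.
  by case: eqP => [->|_] /=; rewrite ?subr0 // subrr mul0r; apply: bei0.
- rewrite rmorphD /=; have := beiD Jp Jq; congr binomial_edge_ideal; ring.
- rewrite rmorphM /=; have := beiD (beiM q Jp) (beiM (kill_vars p) Jq).
  congr binomial_edge_ideal; ring.
Qed.

(* x_w f_ij and y_w f_ij lie in J_G for neighbours i and j of w, so that modulo
   J_G the coefficients of the new generators need not involve x_w and y_w. *)
Lemma complete_at_reduce f : J complete_at f ->
  exists2 r, kill_vars r = r & J G (f - r).
Proof.
(* Annihilation of [r] by x_w and y_w modulo J_G is carried along because it allows a coefficient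
   [a] to be replaced by [kill_vars a]. *)
move=> Jf; suff [r [rE Jr _ _]] : exists r, [/\ kill_vars r = r, J G (f - r),
    J G ('X_(lshift n w) * r) & J G ('X_(rshift n w) * r)] by exists r.
move: f Jf; apply: (@bei_least _ (fun f => exists r, [/\ kill_vars r = r, J G (f - r),
    J G ('X_(lshift n w) * r) & J G ('X_(rshift n w) * r)])).
- by exists 0; rewrite rmorph0 subrr !mulr0; split=> //; apply: bei0.
- move=> a f g [r [rE Jfr xr yr]] [s [sE Jgs xs ys]].
  have Jxy z : J G (z * r) -> J G (z * s) -> J G (z * (kill_vars a * r + s)).
    by move=> Jr Js; rewrite mulrDr mulrCA; apply: bei_linear.
  exists (kill_vars a * r + s); split; [|  |exact: Jxy|exact: Jxy].
    by rewrite rmorphD rmorphM /= kill_vars_id rE sE.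
  have := beiD (beiD (beiM a Jfr) Jgs) (kill_vars_diff xr yr a).
  congr binomial_edge_ideal; ring.
- move=> i j /orP[Gij|/and5P[ne iw jw wi wj]].
    exists 0; rewrite rmorph0 subr0 !mulr0; split=> //; try exact: bei0.
    exact: bei_gen.
  exists (b i j); rewrite kill_vars_edge (negPf iw) (negPf jw) subrr.
  have Jwi : J G (b w i) by apply: bei_gen.
  have Jwj : J G (b w j) by apply: bei_gen.
  split=> //; first exact: bei0.
    (* The identities are x_w f_ij = x_i f_wj - x_j f_wi and y_w f_ij = y_i f_wj - y_j f_wi. *)
    have := beiB (beiM 'X_(lshift n i) Jwj) (beiM 'X_(lshift n j) Jwi).
    by congr binomial_edge_ideal; rewrite /edge_binomial; ring.
  have := beiB (beiM 'X_(rshift n i) Jwj) (beiM 'X_(rshift n j) Jwi).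
  by congr binomial_edge_ideal; rewrite /edge_binomial; ring.
Qed.

(* Ohtani's J_G = J_{G_w} \cap (J_{G - w} + (x_w, y_w)), with membership in the
   second ideal tested after setting x_w = y_w = 0. *)
Lemma ohtani f : J complete_at f -> J isolate (kill_vars f) -> J G f.
Proof.
move=> /complete_at_reduce[r rE Jfr] Jf; rewrite -[f](subrK r); apply: beiD => //.
(* Since [r] is fixed by [kill_vars], it equals [kill_vars f - kill_vars (f - r)], a difference of
   members of J_{G - w}, which is contained in J_G. *)
have sub : subrel isolate G by move=> x y /= /and3P[].
apply: (bei_mono symG sub); have := beiB Jf (kill_vars_ideal Jfr).
by rewrite rmorphB /= rE subKr.
Qed.

End Completion.

Lemma edge_binomial_regular G u v : ssrbool.symmetric G -> irreflexive G ->
  simplicial G u -> simplicial G v -> ~~ connect G u v ->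
  forall g, J G (b u v * g) -> J G g.
Proof.
have [d] := ubnP #|[set w | ~~ simplicial G w]|; elim: d G => // d IH G.
rewrite ltnS => le_d symG irrG su sv nuv g Jg.
case: (pickP (fun w => ~~ simplicial G w)) => [w nsw|allS]; last first.
  by apply: (disjoint_cliques_regular symG _ nuv Jg) => w; rewrite -[simplicial _ _]negbK allS.
(* Simplicial vertices stay simplicial and [w] becomes one, so the induction measure drops. *)
have smaller (G' : rel 'I_n) : (forall x, simplicial G x -> simplicial G' x) ->
    simplicial G' w -> (#|[set x | ~~ simplicial G' x]| < d)%N.
  move=> mono sw; apply: leq_trans le_d; apply: proper_card; apply/properP; split.
    by apply/subsetP=> x; rewrite !inE; apply/contraNN/mono.
  by exists w; rewrite !inE ?sw.
have uw : u != w by apply: contraNneq nsw => <-.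
have vw : v != w by apply: contraNneq nsw => <-.
apply: (ohtani symG (w := w)).
  apply: (IH (complete_at G w)).
  - by apply: smaller; [apply: complete_at_simplicial|apply: complete_at_simplicial_self].
  - exact: complete_at_sym.
  - by move=> x; rewrite /complete_at /= irrG eqxx.
  - exact: complete_at_simplicial.
  - exact: complete_at_simplicial.
  - by apply: contraNN nuv; apply: complete_at_connect.
  - apply: bei_mono Jg; first exact: complete_at_sym.
    by move=> x y; rewrite /complete_at /= => ->.
apply: (IH (isolate G w)).
- by apply: smaller; [apply: isolate_simplicial|apply: isolate_simplicial_self].
- exact: isolate_sym.
- by move=> x; rewrite /isolate /= irrG.
- exact: isolate_simplicial.
- exact: isolate_simplicial.
- by apply: contraNN nuv; apply: isolate_connect.
(* As [u] and [v] differ from [w], [kill_vars] fixes f_uv and preserves the shape of the product. *)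
- have := kill_vars_ideal w symG Jg.
  by rewrite rmorphM /= kill_vars_edge (negPf uw) (negPf vw).
Qed.

Lemma bei_homogeneous G : homogeneous_ideal (J G).
Proof.
split; [exact: bei0|exact: bei_linear|].
move=> e f [c ->]; rewrite linear_sum.
exists (fun i j => if (2 <= e)%N then pihomog mdeg (e - 2) (c i j) else 0).
apply: eq_bigr => i _ /=; rewrite linear_sum; apply: eq_bigr => j _ /=.
by rewrite (pihomogM _ _ (edge_binomial_homog i j)); case: ifP; rewrite ?mul0r.
Qed.

Lemma bei_ext G G' : G =2 G' -> forall f, J G f <-> J G' f.
Proof.
by move=> eqG f; split=> -[c ->]; exists c; apply: eq_bigr => i _;
  apply: eq_bigl => j; rewrite eqG.
Qed.

Lemma add_edge_sym G u v : ssrbool.symmetric G -> ssrbool.symmetric (add_edge G u v).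
Proof. by move=> symG x y; rewrite /add_edge /= symG [[set x; y]]setUC. Qed.

Lemma bei_add_edge G u v f : ssrbool.symmetric G ->
  J (add_edge G u v) f <-> exists a c, J G a /\ f = a + c * b u v.
Proof.
move=> symG; split; last first.
  move=> [a [c [Ja ->]]]; apply: beiD.
    by apply: bei_mono Ja; [apply: add_edge_sym|move=> x y; rewrite /add_edge /= => ->].
  by apply/beiM/bei_gen; [apply: add_edge_sym|rewrite /add_edge /= eqxx orbT].
move: f; apply: (@bei_least _ (fun f => exists a c, J G a /\ f = a + c * b u v)).
- by exists 0, 0; rewrite mul0r addr0; split=> //; apply: bei0.
- move=> t _ _ [a [c [Ja ->]]] [a' [c' [Ja' ->]]]; exists (t * a + a'), (t * c + c').
  by split; [apply: bei_linear|ring].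
- move=> i j /= /orP[Gij|/eqP eq_ij].
    by exists (b i j), 0; rewrite mul0r addr0; split=> //; apply: bei_gen.
  have [[-> ->]|[-> ->]] : (i = u /\ j = v) \/ (i = v /\ j = u).
    have : i \in [set u; v] by rewrite -eq_ij !inE eqxx.
    have : j \in [set u; v] by rewrite -eq_ij !inE eqxx orbT.
    have : u \in [set i; j] by rewrite eq_ij !inE eqxx.
    have : v \in [set i; j] by rewrite eq_ij !inE eqxx orbT.
    rewrite !inE => /orP[]/eqP ? /orP[]/eqP ? /orP[]/eqP ? /orP[]/eqP ?; subst; tauto.
  + by exists 0, 1; rewrite mul1r add0r; split=> //; apply: bei0.
  + exists 0, (-1); rewrite mulN1r add0r -edge_binomialC; split=> //; exact: bei0.
Qed.

End BinomialEdgeIdeal.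

(** * Free vertices and cut edges *)

Lemma free_vertex_simplicial n (G : rel 'I_n) (u : 'I_n) :
  ssrbool.symmetric G -> free_vertex G u -> simplicial G u.
Proof.
move=> symG /cards1P[F FE]; apply/simplicialP=> x y ux uy ne.
(* An edge at [u] extends to a maximal clique, which contains [u] and so must be the only facet [F]
   through [u]. *)
have inF z : G u z -> z \in F.
  move=> uz.
  have cl : [set u; z] \in clique_complex G.
    rewrite inE; apply/forall_inP=> a ha; apply/forall_inP=> c hc; apply/implyP.
    move: ha hc; rewrite !inE => /orP[]/eqP-> /orP[]/eqP->; rewrite ?eqxx //.
    by rewrite symG.
  have [M maxM /subsetP subM] := maxset_exists (P := fun A => A \in clique_complex G) cl.
  have : M \in [set F].
    by rewrite -FE inE /facet maxM subM // !inE eqxx.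
  by rewrite inE => /eqP <-; apply: subM; rewrite !inE eqxx orbT.
have : F \in [set F] by rewrite inE.
rewrite -FE inE => /andP[/maxsetp]; rewrite inE => /forall_inP/(_ x (inF x ux)).
by move=> /forall_inP/(_ y (inF y uy)); rewrite ne.
Qed.

(** If the endpoints stayed connected, every use of the edge could be rerouted and the number of
    components would not change. *)
Lemma cut_edge_connect n (G : rel 'I_n) (u v : 'I_n) :
  ssrbool.symmetric G -> cut_edge G u v -> ~~ connect (del_edge G u v) u v.
Proof.
move=> symG /andP[Guv lt_comp]; apply: contraTN lt_comp => cuv.
rewrite -leqNgt leq_eqVlt; apply/orP; left; apply/eqP/eq_n_comp => x y.
have symH : ssrbool.symmetric (del_edge G u v).
  by move=> a c; rewrite /del_edge /= symG [[set a; c]]setUC.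
apply/idP/idP.
  by apply: connect_sub => {}x {}y; rewrite /del_edge /= => /andP[/connect1].
apply: connect_sub => {}x {}y.
move=> Gxy; have [eq_xy|ne] := eqVneq [set x; y] [set u; v]; last first.
  by apply: connect1; rewrite /del_edge /= Gxy.
have : x \in [set u; v] by rewrite -eq_xy !inE eqxx.
have : y \in [set u; v] by rewrite -eq_xy !inE eqxx orbT.
by rewrite !inE => /orP[]/eqP-> /orP[]/eqP->; rewrite ?connect0 //
  (sym_connect_sym symH).
Qed.

Lemma add_del_edge n (G : sgraph n) u v : G u v ->
  adj G =2 add_edge (del_edge G u v) u v.
Proof.
move=> Guv x y; rewrite /add_edge /del_edge /=; have [eq_xy|_] := eqVneq [set x; y] [set u; v]; last first.
  by rewrite andbT orbF.
rewrite andbF /=.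
have : x \in [set u; v] by rewrite -eq_xy !inE eqxx.
have : y \in [set u; v] by rewrite -eq_xy !inE eqxx orbT.
have : u \in [set x; y] by rewrite eq_xy !inE eqxx.
have : v \in [set x; y] by rewrite eq_xy !inE eqxx orbT.
rewrite !inE => /orP[]/eqP ? /orP[]/eqP ? /orP[]/eqP ? /orP[]/eqP ?; subst;
  by rewrite ?Guv // adj_sym.
Qed.

(** [epsilon] is a function of its predicate, so equality of the predicates suffices. *)
Lemma regularity_betti (K : fieldType) N (I I' : {mpoly K[N]} -> Prop) :
  (forall i j, betti I i j = betti I' i j) -> regularity I = regularity I'.
Proof.
move=> eq_betti; rewrite /regularity.
suff -> : betti I = betti I' by [].
by apply: functional_extensionality => i; apply: functional_extensionality => j.
Qed.

Lemma proj_dim_ext (K : fieldType) N (I I' : {mpoly K[N]} -> Prop) :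
  (forall d, has_projective_resolution I d <-> has_projective_resolution I' d) ->
  proj_dim I = proj_dim I'.
Proof.
move=> eqI; rewrite /proj_dim.
suff -> : has_projective_resolution I = has_projective_resolution I' by [].
by apply: functional_extensionality => d; apply: propositional_extensionality.
Qed.

Theorem proposition3p5 (K : fieldType) (n : nat) (G G' : sgraph n)
    (hGG' : free_cut_edge_switching G G') :
  (forall i j : nat,
     betti (@binomial_edge_ideal K n G) i j =
     betti (@binomial_edge_ideal K n G') i j) /\
  proj_dim (@binomial_edge_ideal K n G) =
    proj_dim (@binomial_edge_ideal K n G') /\
  regularity (@binomial_edge_ideal K n G) =
    regularity (@binomial_edge_ideal K n G').
Proof.
have [u [v [u' [v' [fce _ nH eqG' fce']]]]] := hGG'.
pose H := del_edge G u v.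
have symH : ssrbool.symmetric H.
  by move=> x y; rewrite /H /del_edge /= adj_sym [[set x; y]]setUC.
have irrH : irreflexive H by move=> x; rewrite /H /del_edge /= adj_irr.
(* Because e' is not an edge of H, adding it and deleting it again gives back H. *)
have eqH : del_edge G' u' v' =2 H.
  move=> x y; rewrite {1}/del_edge /= eqG' /add_edge /= -/(del_edge G u v x y) -/(H x y).
  have [eq_xy|_] := eqVneq [set x; y] [set u'; v']; last by rewrite orbF andbT.
  rewrite andbF; apply/esym/negbTE; apply: contraNN nH; rewrite -/(H u' v').
  have : u' \in [set x; y] by rewrite eq_xy !inE eqxx.
  have : v' \in [set x; y] by rewrite eq_xy !inE eqxx orbT.
  have : x \in [set u'; v'] by rewrite -eq_xy !inE eqxx.
  have : y \in [set u'; v'] by rewrite -eq_xy !inE eqxx orbT.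
  rewrite !inE => /orP[]/eqP ? /orP[]/eqP ? /orP[]/eqP ? /orP[]/eqP ?; subst => //;
    by rewrite symH.
have [F resF] := minimal_resolution_exists (@bei_homogeneous K n H).
(* Stated for any graph that becomes H on removal of a free cut edge, so that it serves both G and
   G' with the same [F]. *)
have cone (A : sgraph n) a c : free_cut_edge A a c -> del_edge A a c =2 H ->
    minimal_graded_free_resolution (@binomial_edge_ideal K n A)
      (mapping_cone F (edge_binomial K a c) 2).
  move=> /and3P[cut fa fc] eqA.
  have symA : ssrbool.symmetric (del_edge A a c) by move=> x y; rewrite !eqA symH.
  apply: (mapping_cone_resolution resF) => //.
  - exact: edge_binomial_homog.
  - exact: bei_const.
  - have irrA : irreflexive (del_edge A a c) by move=> x; rewrite eqA irrH.
    move=> g /(bei_ext eqA) Jg; apply/(bei_ext eqA).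
    apply: edge_binomial_regular Jg => //; try exact: free_vertex_simplicial.
    exact: cut_edge_connect (@adj_sym _ A) cut.
  - move=> g; have /andP[Aac _] := cut.
    rewrite (bei_ext (add_del_edge Aac)) (bei_add_edge _ _ _ symA).
    by split=> -[p [q [Jp ->]]]; exists p, q; split=> //; apply/(bei_ext eqA).
have resG := cone G u v fce (fun x y => erefl).
have resG' := cone G' u' v' fce' eqH.
have eq_betti i j : betti (@binomial_edge_ideal K n G) i j =
    betti (@binomial_edge_ideal K n G') i j.
  (* Both cones have the same ranks and degrees by computation, since these do not involve the
     binomial. *)
  by rewrite (bettiE _ _ resG) (bettiE _ _ resG').
split=> //; split; last exact: regularity_betti.
apply: proj_dim_ext => d.
by rewrite (minimal_resolution_proj_dim _ resG) (minimal_resolution_proj_dim _ resG').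
Qed.
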